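(* Let $j\in\mathbb{N}$ and $\alpha\in\{-1/2,1/2,\ldots,j-1/2\}\cup(j-1/2,\infty)$. Then there exist positive constants $c$ and $C$ such that for all $u,v,t>0$ $$\big|\partial_u^jG_t^\alpha(u,v)\big|\le C\begin{cases}t^{-\frac{j+1}{2}}\exp\big(-c\frac{(u-v)^2}{t}\big),&t\le1,\\ e^{-2t(\alpha+1)}e^{-c(u-v)^2},&t\ge1.\end{cases}$$ Moreover, there is a constant $C'$ such that for all $t>0$ $$\sup_{u>0}\big\|\partial_u^jG_t^\alpha(u,\cdot)\big\|_{L^2(\mathbb{R}_+)}\le C'\begin{cases}t^{-\frac{2j+1}{4}},&t\le1,\\ e^{-2t(\alpha+1)},&t\ge1.\end{cases}$$
   Context: $\mathbb{N}=\{0,1,2,\ldots\}$, $\mathbb{R}_+=(0,\infty)$ with Lebesgue measure. For $\alpha>-1$ the Laguerre functions of Hermite type are $\varphi_k^\alpha(u)=\big(\frac{2\Gamma(k+1)}{\Gamma(k+\alpha+1)}\big)^{1/2}L_k^\alpha(u^2)e^{-u^2/2}u^{\alpha+1/2}$, $u>0$, $k\in\mathbb{N}$, where $L_k^\alpha$ is the Laguerre polynomial of degree $k$ and order $\alpha$. The associated one-dimensional heat kernel is $$G_t^\alpha(u,v)=\sum_{k\in\mathbb{N}}e^{-t(4k+2\alpha+2)}\varphi_k^\alpha(u)\varphi_k^\alpha(v)=\frac{\sqrt{uv}}{\sinh2t}\exp\Big(-\frac12\coth(2t)(u^2+v^2)\Big)I_\alpha\Big(\frac{uv}{\sinh2t}\Big),$$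 where $I_\alpha$ is the modified Bessel function of the first kind of order $\alpha$. *)

(* Defs.v *)
From HB Require Import structures.
From mathcomp Require Import all_boot all_order all_algebra.
From mathcomp Require Import all_classical all_reals all_analysis.

Set Implicit Arguments.
Unset Strict Implicit.
Unset Printing Implicit Defensive.

Import Order.TTheory GRing.Theory Num.Theory.
Import numFieldNormedType.Exports.

Local Open Scope classical_set_scope.
Local Open Scope ring_scope.

(* Euler's integral; only meaningful for [0 < a]. *)
Definition Gamma (R : realType) (a : R) : R :=
  \int[lebesgue_measure]_(x in `]0, +oo[) (x `^ (a - 1) * expR (- x)).

(* L_k^alpha(X) = \sum_(i <= k) (-1)^i binom(k + alpha, k - i) X^i / i!, where
   binom(k + alpha, k - i)
     = (alpha + i + 1) (alpha + i + 2) ... (alpha + k) / (k - i)!. *)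
Definition laguerre (R : realType) (alpha : R) (k : nat) : {poly R} :=
  \poly_(i < k.+1)
    ((-1) ^+ i * (\prod_(i.+1 <= m < k.+1) (alpha + m%:R))
     / ((k - i)`!%:R * i`!%:R)).

Definition laguerre_fun (R : realType) (alpha : R) (k : nat) (u : R) : R :=
  Num.sqrt (2 * Gamma (k%:R + 1) / Gamma (k%:R + alpha + 1))
  * (laguerre alpha k).[u ^+ 2] * expR (- (u ^+ 2) / 2)
  * u `^ (alpha + 1 / 2).

Definition heat_kernel (R : realType) (alpha t u v : R) : R :=
  limn (series (fun k => expR (- t * (4 * k%:R + 2 * alpha + 2))
                         * laguerre_fun alpha k u * laguerre_fun alpha k v)).

Definition du_heat_kernel (R : realType) (alpha : R) (j : nat) (t u v : R) : R :=
  derive1n j (fun u' => heat_kernel alpha t u' v) u.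

(* The norm of L^2((0, +oo)), with [f] extended by zero to the whole line. *)
Definition L2norm_pos (R : realType) (f : R -> R) : \bar R :=
  Lnorm lebesgue_measure 2%:E (EFin \o (f \_ `]0, +oo[)).

(* Main.v *)
Require Import Defs.
From HB Require Import structures.
From mathcomp Require Import all_boot all_order all_algebra.
From mathcomp Require Import all_classical all_reals all_analysis.
From mathcomp Require Import measurable_realfun ring lra.

Set Implicit Arguments.
Unset Strict Implicit.
Unset Printing Implicit Defensive.

Import Order.TTheory GRing.Theory Num.Theory.
Import numFieldNormedType.Exports.

Local Open Scope classical_set_scope.
Local Open Scope ring_scope.

(** The kernel is put in closed form by the Hille-Hardy formula, obtained from the
    product formula for Laguerre polynomials
      k!/(a+1)_k L_k^a(x) L_k^a(y)
        = sum_(n <= k) (xy)^n/(n! (a+1)_n) L_(k-n)^(a+2n)(x+y)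
    (both sides, as polynomials in x, solve the Laguerre equation and agree at x = 0)
    by summing over k with the generating function of each L^(a+2n). This gives,
    with s = sinh 2t,
      G_t(u,v) = c s^(-1/2) F(uv/s) exp(-(u-v)^2/(2s) - tanh(t) (u^2+v^2)/2),
      F(x) = sqrt x exp(-x) I_alpha(x).
    Put a = alpha + 1/2. Since F'' + 2F' = a(a-1) F/x^2, a Gronwall argument bounds F on
    [1,oo) and, differentiating the equation, F^(m) = O(x^(-m)) there; on (0,1] Leibniz'
    rule for x^a times an entire function gives F^(m) = O(x^max(a-m,0)), where for
    integer a one uses that the derivatives of x^a of order greater than a vanish.
    Leibniz' rule for the product of F(uv/s) with the Gaussian then yields the kernel
    estimates, and the L^2 bounds follow by integrating them. *)

(** * Calculus and rearrangement of series *)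

(** The closed form rests on coth(2t) = 1/s + tanh t. The part 1/s completes the square (u-v)^2 and
    leaves exp(-uv/s), which goes into F and cancels the exponential growth of I_alpha; the part
    tanh t gives decay in u and v separately. Each differentiation of F(uv/s) produces v/s, which no
    multiple of t^(-1/2) bounds when v is large. So boundedness of F^(m) would not do; its decay
    replaces v/s by v/(s + uv), which is at most t^(-1/2) up to a factor linear in |u-v|/sqrt t. All
    polynomial factors are absorbed by half of the Gaussian. For t >= 1 the decay comes from the
    behaviour of F at 0: s^(-1/2-i) (uv/s)^max(a-i,0) carries s to a power at most -(alpha+1). The
    condition on alpha enters only at 0, where the i-th derivative of x^a, i <= j, stays bounded
    exactly when a >= i or its coefficient a(a-1)...(a-i+1) vanishes. *)

Lemma is_deriveD_fun (R : realType) (f g : R -> R) (x df dg : R) :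
  is_derive x 1 f df -> is_derive x 1 g dg ->
  is_derive x 1 (fun y => f y + g y) (df + dg).
Proof. exact: is_deriveD. Qed.

Lemma is_deriveM_fun (R : realType) (f g : R -> R) (x df dg : R) :
  is_derive x 1 f df -> is_derive x 1 g dg ->
  is_derive x 1 (fun y => f y * g y) (df * g x + f x * dg).
Proof.
move=> hf hg; apply: (is_derive_eq (is_deriveM hf hg)).
by rewrite addrC [g x *: _]mulrC.
Qed.

Lemma is_deriveZ_fun (R : realType) (k : R) (f : R -> R) (x df : R) :
  is_derive x 1 f df -> is_derive x 1 (fun y => k * f y) (k * df).
Proof. by move=> hf; apply: is_deriveZ. Qed.

Lemma is_deriveX_fun (R : realType) (n : nat) (x : R) :
  is_derive x 1 (fun y => y ^+ n) (n%:R * x ^+ n.-1).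
Proof.
have -> : (fun y : R => y ^+ n) = (@id R) ^+ n by rewrite exprfctE.
by apply: is_derive_eq; exact: mulr1.
Qed.

Lemma is_derive_expR_comp (R : realType) (f : R -> R) (x df : R) :
  is_derive x 1 f df ->
  is_derive x 1 (fun y => expR (f y)) (df * expR (f x)).
Proof.
move=> hf; rewrite mulrC; apply: (is_derive1_comp _ hf); exact: is_derive_expR.
Qed.

Lemma is_derive_id_fun (R : realType) (x : R) : is_derive x 1 (fun y => y) 1.
Proof. exact: is_derive_id. Qed.

Lemma is_derive_cst_fun (R : realType) (k x : R) : is_derive x 1 (fun=> k) 0.
Proof. exact: is_derive_cst. Qed.

Lemma is_derive_affine (R : realType) (p q x : R) :
  is_derive x 1 (fun y => p * y + q) p.
Proof.
have H := is_deriveD_fun (is_deriveZ_fun p (is_derive_id_fun x))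
  (is_derive_cst_fun q x).
by apply: (is_derive_eq H); rewrite mulr1 addr0.
Qed.

Lemma is_derive_powR (R : realType) (a x : R) : 0 < x ->
  is_derive x 1 (fun y => y `^ a) (a * x `^ (a - 1)).
Proof.
move=> x0; have xI : x \in `]0, +oo[ by rewrite in_itv/= x0.
apply: DeriveDef; first exact: derivable_powR.
by rewrite -derive1E powR_derive1.
Qed.

Lemma is_derive_continuous (R : realType) (f : R -> R) (x df : R) :
  is_derive x 1 f df -> {for x, continuous f}.
Proof.
move=> hf; apply: differentiable_continuous; apply/derivable1_diffP.
exact: ex_derive.
Qed.

Lemma near_pos (R : realType) (x : R) : 0 < x -> \near x, 0 < x.
Proof. exact: lt_nbhsr. Qed.

(** Positivity is an open condition, so identities known only for positive arguments, such as the
    closed form of the kernel, can be differentiated there. *)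
Lemma eq_is_derive_pos (R : realType) (f g : R -> R) (x df : R) :
  (forall y, 0 < y -> f y = g y) -> 0 < x ->
  is_derive x 1 f df -> is_derive x 1 g df.
Proof.
move=> fg x0 hf.
have E : {near x, f =1 g} by near=> y; apply: fg; near: y; exact: near_pos.
apply: DeriveDef; first exact: (near_eq_derivable E (ex_derive (is_derive := hf))).
by rewrite -(near_eq_derive _ E); apply: derive_val.
Unshelve. all: by end_near. Qed.

Lemma mean_value (R : realType) (f df : R -> R) (a b : R) : a <= b ->
  (forall x, a <= x -> x <= b -> is_derive x 1 f (df x)) ->
  exists c, [/\ a <= c, c <= b & f b - f a = df c * (b - a)].
Proof.
move=> ab h.
have [||c] := @MVT_segment R f df a b ab.
- by move=> x; rewrite in_itv/= => /andP[ax xb]; apply: h; exact: ltW.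
- apply: derivable_within_continuous => x; rewrite in_itv/= => /andP[ax xb].
  by have H := h x ax xb; exact: ex_derive.
by rewrite in_itv/= => /andP[ac cb] E; exists c.
Qed.

Lemma derive_le0_le (R : realType) (f df : R -> R) (a b : R) : a <= b ->
  (forall x, a <= x -> x <= b -> is_derive x 1 f (df x)) ->
  (forall x, a <= x -> x <= b -> df x <= 0) -> f b <= f a.
Proof.
move=> ab h d0; have [c [ac cb E]] := mean_value ab h.
by rewrite -subr_le0 E mulr_le0_ge0 ?d0// subr_ge0.
Qed.

Lemma cvg_sum_nat (R : realType) (f : nat -> nat -> R) (A : nat -> R) (n : nat) :
  (forall i, (fun N => f N i) @ \oo --> A i) ->
  (fun N => \sum_(0 <= i < n) f N i) @ \oo --> \sum_(0 <= i < n) A i.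
Proof.
move=> fA; elim: n => [|n IH].
  under eq_cvg do rewrite big_nil.
  by rewrite big_nil; exact: cvg_cst.
under eq_cvg do rewrite big_nat_recr//=.
by rewrite big_nat_recr//=; apply: cvgD.
Qed.

(** Dominated convergence for sums whose terms and number of terms both vary with N: beyond a fixed
    N0 the majorant is small uniformly in N, and below N0 there are finitely many limits. *)
Lemma tannery (R : realType) (f : nat -> nat -> R) (A B : nat -> R) (S : R) :
  (forall n, (fun N => f N n) @ \oo --> A n) ->
  (forall N n, `|f N n| <= B n) ->
  cvgn (series B) -> series A @ \oo --> S ->
  (fun N => \sum_(0 <= n < N) f N n) @ \oo --> S.
Proof.
move=> fA fB cB AS; apply/cvgrPdist_lt => e e0.
have e3 : 0 < e / 3 by rewrite divr_gt0.
have [N0 [tailB tailA]] : exists N0 : nat,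
    (forall N, (N0 <= N)%N -> `|\sum_(N0 <= n < N) B n| < e / 3) /\
    `|S - series A N0| < e / 3.
  (* Two partial sums of B, each within e / 6 of the limit, differ by less than e / 3. *)
  have H1 : \forall n \near \oo, `|limn (series B) - series B n| < e / 6.
    have e6 : 0 < e / 6 by rewrite divr_gt0.
    by move/cvgrPdist_lt : cB => /(_ _ e6).
  have H2 : \forall n \near \oo, `|S - series A n| < e / 3.
    by move/cvgrPdist_lt : AS => /(_ _ e3).
  have [[N1 _ h1] [N2 _ h2]] := (H1, H2).
  exists (maxn N1 N2); split; last by apply: h2; rewrite /= leq_maxr.
  move=> N hN; rewrite -sub_series_geq//.
  have := h1 (maxn N1 N2) (leq_maxl _ _).
  have := h1 N (leq_trans (leq_maxl _ _) hN).
  rewrite /= !ltr_norml => /andP[? ?] /andP[? ?]; apply/andP; split; lra.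
have : (fun N => \sum_(0 <= n < N0) f N n) @ \oo --> series A N0.
  exact: cvg_sum_nat.
move/cvgrPdist_lt => /(_ _ e3) fin.
near=> N.
have hN : (N0 <= N)%N by near: N; exact: nbhs_infty_ge.
rewrite (@big_cat_nat _ _ _ N0)//=.
have h1 : `|series A N0 - \sum_(0 <= n < N0) f N n| < e / 3 by near: N.
have h2 : `|\sum_(N0 <= n < N) f N n| < e / 3.
  apply: le_lt_trans (tailB _ hN); rewrite [leRHS]ger0_norm.
    by apply: (le_trans (ler_norm_sum _ _ _)); apply: ler_sum => i _; exact: fB.
  by apply: sumr_ge0 => i _; apply: le_trans (fB 0%N i).
move: h1 h2 tailA; rewrite !ltr_norml => /andP[? ?] /andP[? ?] /andP[? ?].
by apply/andP; split; lra.
Unshelve. all: by end_near. Qed.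

(** The first N antidiagonals together consist of the first N - n entries of each row n < N, so
    Tannery's theorem applies to the partial sums of the rows. The majorant concerns these partial
    sums and allows cancellation inside a row. *)
Lemma cvg_series_triangle (R : realType) (a : nat -> nat -> R) (A B : nat -> R)
    (S : R) :
  (forall n, series (a n) @ \oo --> A n) ->
  (forall n M, `|series (a n) M| <= B n) ->
  cvgn (series B) -> series A @ \oo --> S ->
  series (fun k => \sum_(0 <= n < k.+1) a n (k - n)%N) @ \oo --> S.
Proof.
move=> aA aB cB AS.
have -> : series (fun k => \sum_(0 <= n < k.+1) a n (k - n)%N) =
          (fun N => \sum_(0 <= n < N) series (a n) (N - n)%N).
  apply/funext => N; elim: N => [|N IH]; first by rewrite /series/= !big_nil.
  rewrite seriesSr IH [in RHS]big_nat_recr//= subSnn.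
  have -> : series (a N) 1 = a N 0%N by rewrite /series/= big_nat1.
  rewrite [X in _ + X = _]big_nat_recr//= subnn addrA -big_split/=.
  congr (_ + _); apply: eq_big_nat => i /andP[_ iN].
  by rewrite subSn ?(ltnW iN)// seriesSr.
apply: (tannery (A := A) (B := B)) => // n.
by move: (aA n); rewrite -(cvg_centern n).
Qed.

Lemma powR_pred (R : realType) (x b : R) : 0 < x -> x `^ b = x * x `^ (b - 1).
Proof.
move=> x0; have xn0 : x != 0 by rewrite gt_eqF.
rewrite powRD; last by rewrite xn0 implybT.
by rewrite powRN powRr1 ?ltW// mulrCA mulfV ?mulr1.
Qed.

Lemma is_derive_sum_nat (R : realType) (f : nat -> R -> R) (df : nat -> R)
    (n : nat) (x : R) :
  (forall i, is_derive x 1 (f i) (df i)) ->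
  is_derive x 1 (fun y => \sum_(0 <= i < n) f i y) (\sum_(0 <= i < n) df i).
Proof.
move=> h; elim: n => [|n IH].
  have -> : (fun y : R => \sum_(0 <= i < 0) f i y) = (fun=> 0).
    by apply/funext => y; rewrite big_nil.
  by rewrite big_nil; exact: is_derive_cst_fun.
have -> : (fun y : R => \sum_(0 <= i < n.+1) f i y) =
    (fun y => (\sum_(0 <= i < n) f i y) + f n y).
  by apply/funext => y; rewrite big_nat_recr.
by rewrite big_nat_recr//=; apply: is_deriveD_fun.
Qed.

Lemma cvg_series_ge0_bounded (R : realType) (u : nat -> R) (M : R) :
  (forall n, 0 <= u n) -> (forall n, series u n <= M) -> cvgn (series u).
Proof.
move=> u0 uM; apply: nondecreasing_is_cvgn.
  apply/nondecreasing_seqP => n; by rewrite seriesSr lerDl.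
by exists M => _ [n _ <-]; exact: uM.
Qed.

Lemma series_ge0_le_lim (R : realType) (u : nat -> R) (S : R) (n : nat) :
  (forall n, 0 <= u n) -> series u @ \oo --> S -> series u n <= S.
Proof.
move=> u0 uS; rewrite -(cvg_lim _ uS)//; apply: nondecreasing_cvgn_le.
  apply/nondecreasing_seqP => k; by rewrite seriesSr lerDl.
by apply/cvg_ex; exists S.
Qed.

(** * Binomial series and generating function of Laguerre polynomials *)

Definition pochhammer (R : realType) (b : R) (m : nat) : R :=
  \prod_(0 <= i < m) (b + i%:R).

Lemma pochhammerS (R : realType) (b : R) (m : nat) :
  pochhammer b m.+1 = pochhammer b m * (b + m%:R).
Proof. by rewrite /pochhammer big_nat_recr. Qed.

Lemma pochhammerSl (R : realType) (b : R) (m : nat) :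
  pochhammer b m.+1 = b * pochhammer (b + 1) m.
Proof.
rewrite /pochhammer big_nat_recl//= addr0; congr (_ * _).
by apply: eq_bigr => i _; rewrite -addrA -natr1 [1 + _]addrC.
Qed.

Lemma pochhammer_gt0 (R : realType) (b : R) (m : nat) : 0 < b ->
  0 < pochhammer b m.
Proof.
move=> b0; elim: m => [|m IH]; first by rewrite /pochhammer big_nil.
by rewrite pochhammerS mulr_gt0// ltr_pwDl.
Qed.

(** The coefficient of w^m in (1-w)^(-b), that is, the binomial number C(b+m-1, m). *)
HB.lock Definition binomial_coeff (R : realType) (b : R) (m : nat) : R :=
  pochhammer b m / m`!%:R.

Lemma binomial_coeff_ge0 (R : realType) (b : R) (m : nat) : 0 < b ->
  0 <= binomial_coeff b m.
Proof. by move=> b0; rewrite binomial_coeff.unlock divr_ge0 ?ler0n// ltW// pochhammer_gt0. Qed.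

Lemma binomial_coeffS (R : realType) (b : R) (m : nat) :
  m.+1%:R * binomial_coeff b m.+1 = (b + m%:R) * binomial_coeff b m.
Proof.
rewrite !binomial_coeff.unlock pochhammerS factS natrM; field.
by rewrite nat1r !pnatr_eq0 -lt0n fact_gt0.
Qed.

Lemma binomial_coeffSl (R : realType) (b : R) (m : nat) :
  m.+1%:R * binomial_coeff b m.+1 = b * binomial_coeff (b + 1) m.
Proof.
rewrite !binomial_coeff.unlock pochhammerSl factS natrM; field.
by rewrite nat1r !pnatr_eq0 -lt0n fact_gt0.
Qed.

Section binomial_series.
Context (R : realType).
Implicit Types (b w : R) (N : nat).

Let part b N w := \sum_(0 <= m < N) binomial_coeff b m * w ^+ m.

Let partE b N w : part b N w = series (fun m => binomial_coeff b m * w ^+ m) N.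
Proof. by []. Qed.

Let part0 b N : part b N.+1 0 = 1.
Proof.
rewrite /part big_nat_recl//= big1_seq ?addr0//.
  by rewrite !binomial_coeff.unlock /pochhammer big_nil fact0 divr1 expr0 mulr1.
by move=> i _; rewrite expr0n mulr0.
Qed.

(** Multiplying the partial sum by (1-w)^b makes the derivative telescope to a single term. Its sign
    yields the bound of the partial sums by (1-w)^(-b), its size their convergence. *)
Let derive_part b N w : w < 1 ->
  is_derive w 1 (fun y => part b N y * (1 - y) `^ b)
    (- (N%:R * binomial_coeff b N * w ^+ N.-1) * (1 - w) `^ (b - 1)).
Proof.
move=> w1; have w10 : 0 < 1 - w by rewrite subr_gt0.
pose dpart := \sum_(0 <= m < N) binomial_coeff b m * (m%:R * w ^+ m.-1).
have H1 : is_derive w 1 (part b N) dpart.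
  apply: is_derive_sum_nat => i; apply: is_deriveZ_fun; exact: is_deriveX_fun.
have H2 : is_derive w 1 (fun y : R => (1 - y) `^ b) (b * (1 - w) `^ (b - 1) * -1).
  have H3 : is_derive w 1 (fun y : R => 1 - y) (-1).
    have -> : (fun y : R => 1 - y) = (fun y => -1 * y + 1).
      by apply/funext => y; rewrite mulN1r addrC.
    exact: is_derive_affine.
  exact: (@is_derive1_comp R (fun y => y `^ b) (fun y => 1 - y) w _ _
    (is_derive_powR b w10) H3).
have key : (1 - w) * dpart = b * part b N w - N%:R * binomial_coeff b N * w ^+ N.-1.
  rewrite /dpart /part; elim: N {H1 dpart} => [|N IH].
    by rewrite !big_nil mulr0n !mul0r mulr0 subr0 mulr0.
  rewrite !big_nat_recr//= mulrDr IH binomial_coeffS.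
  case: N {IH} => [|N] /=; first by rewrite expr0; ring.
  by rewrite exprS; ring.
apply: (is_derive_eq (is_deriveM_fun H1 H2)).
rewrite (powR_pred b w10).
rewrite mulrA [dpart * (1 - w)]mulrC key; ring.
Qed.

Lemma binomial_series_le b w N : 0 < b -> 0 <= w < 1 ->
  series (fun m => binomial_coeff b m * w ^+ m) N <= (1 - w) `^ (- b).
Proof.
move=> b0 /andP[w0 w1]; have w10 : 0 < 1 - w by rewrite subr_gt0.
rewrite powRN -partE -[leRHS]mul1r ler_pdivlMr ?powR_gt0//.
apply: (@le_trans _ _ (part b N 0 * (1 - 0) `^ b)).
  apply: (derive_le0_le (f := fun y => part b N y * (1 - y) `^ b) w0
    (df := fun w => - (N%:R * binomial_coeff b N * w ^+ N.-1) * (1 - w) `^ (b - 1))) => x x0 xw.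
    by apply: derive_part; exact: le_lt_trans xw _.
  by rewrite mulNr oppr_le0 mulr_ge0 ?powR_ge0// mulr_ge0 ?exprn_ge0// mulr_ge0
    ?binomial_coeff_ge0.
rewrite subr0 powR1 mulr1; case: N => [|N]; last by rewrite part0.
by rewrite /part big_nil.
Qed.

Lemma binomial_series b w : 0 < b -> 0 <= w < 1 ->
  series (fun m => binomial_coeff b m * w ^+ m) @ \oo --> (1 - w) `^ (- b).
Proof.
move=> b0 /andP[w0 w1]; have w10 : 0 < 1 - w by rewrite subr_gt0.
(* The term of index n + 1 is b w times the n-th term of the series for b + 1, whose partial sums
   are bounded. *)
have small : (fun N => N%:R * binomial_coeff b N * w ^+ N) @ \oo --> 0.
  rewrite -(cvg_shiftS _ (nbhs (0 : R))) /=.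
  have E n : n.+1%:R * binomial_coeff b n.+1 * w ^+ n.+1 =
      b * w * (binomial_coeff (b + 1) n * w ^+ n).
    by rewrite binomial_coeffSl exprS; ring.
  under eq_cvg do rewrite E.
  rewrite (_ : nbhs (0 : R) = nbhs (b * w * 0)); last by rewrite mulr0.
  apply: cvgMr.
  apply: cvg_series_cvg_0.
  apply: (cvg_series_ge0_bounded (M := (1 - w) `^ (- (b + 1)))) => n.
    by rewrite mulr_ge0 ?exprn_ge0// binomial_coeff_ge0// addr_gt0.
  by apply: binomial_series_le; rewrite ?addr_gt0// w0.
have bound N : `|1 - part b N.+1 w * (1 - w) `^ b| * (1 - w) <=
    N.+1%:R * binomial_coeff b N.+1 * w ^+ N.+1.
  have [c [c0 cw]] := mean_value w0 (fun x x0 xw =>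
    derive_part b N.+1 (le_lt_trans xw w1)).
  have c10 : 0 < 1 - c by rewrite subr_gt0 (le_lt_trans cw).
  rewrite /= part0 !subr0 powR1 mulr1 distrC => ->.
  have NB : 0 <= N.+1%:R * binomial_coeff b N.+1.
    by rewrite mulr_ge0 ?binomial_coeff_ge0.
  rewrite !(normrM, normrN) [`|(1 - c) `^ _|]ger0_norm ?powR_ge0//.
  rewrite [`|w|]ger0_norm// [`|binomial_coeff _ _|]ger0_norm ?binomial_coeff_ge0//.
  rewrite normr_nat [`|c ^+ _|]ger0_norm ?exprn_ge0//=.
  (* The factor 1 - w in [bound] serves here: (1-c)^(b-1) is large near c = 1 when b < 1, but
     (1-w)(1-c)^(b-1) <= (1-c)^b <= 1. *)
  have c1b : (1 - w) * (1 - c) `^ (b - 1) <= 1.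
    apply: (@le_trans _ _ ((1 - c) `^ b)).
      by rewrite (powR_pred b c10) ler_wpM2r ?powR_ge0// lerB.
    have E1 : 1 `^ b = 1 :> R by rewrite powR1.
    rewrite -[leRHS]E1.
    by apply: (ge0_ler_powR (ltW b0)); rewrite ?nnegrE ?gerBl// ltW.
  have -> : N.+1%:R * binomial_coeff b N.+1 * c ^+ N * (1 - c) `^ (b - 1) * w *
      (1 - w) = (N.+1%:R * binomial_coeff b N.+1 * w) * c ^+ N *
      ((1 - w) * (1 - c) `^ (b - 1)) by ring.
  rewrite exprSr [w ^+ N * w]mulrC [leRHS]mulrA -[leRHS]mulr1.
  apply: ler_pM => //; last first.
    by apply: ler_wpM2l; [exact: mulr_ge0|exact: lerXn2r].
    by rewrite mulr_ge0 ?powR_ge0// ltW.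
  by apply: mulr_ge0; [exact: mulr_ge0|exact: exprn_ge0].
rewrite powRN -[_^-1]mul1r.
have -> : series (fun m => binomial_coeff b m * w ^+ m) =
    (fun N => part b N w * (1 - w) `^ b * ((1 - w) `^ b)^-1).
  by apply/funext => N; rewrite mulfK// gt_eqF// powR_gt0.
apply: cvgMl; apply/cvgrPdist_le => e e0.
have e1 : 0 < e * (1 - w) by rewrite mulr_gt0.
move/cvgrPdist_le : small => /(_ _ e1) small.
near=> N; have N0 : (0 < N)%N by near: N; exact: nbhs_infty_gt.
have : `|0 - N%:R * binomial_coeff b N * w ^+ N| <= e * (1 - w) by near: N.
rewrite sub0r normrN -(prednK N0) => hN.
rewrite -(ler_pM2r w10); apply: le_trans (bound _) _.
exact: le_trans (ler_norm _) hN.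
Unshelve. all: by end_near. Qed.

End binomial_series.

(** Exhibits the value as an antidiagonal sum in which row i carries the coefficients of
    (1-w)^(-(b+i+1)), the shape needed for [cvg_series_triangle]. *)
Lemma laguerre_hornerE (R : realType) (b z : R) (k : nat) :
  (laguerre b k).[z] = \sum_(0 <= i < k.+1)
    (- z) ^+ i / i`!%:R * binomial_coeff (b + i.+1%:R) (k - i)%N.
Proof.
rewrite /laguerre horner_poly big_mkord; apply: eq_bigr => i _.
have ik : (i <= k)%N by rewrite -ltnS.
have -> : \prod_(i.+1 <= m < k.+1) (b + m%:R) = pochhammer (b + i.+1%:R) (k - i).
  rewrite /pochhammer -{1}[i.+1]add0n big_addn subSS; apply: eq_bigr => m _.
  by rewrite natrD [m%:R + _]addrC addrA.
rewrite !binomial_coeff.unlock [(- z) ^+ _]exprNn; field.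
by rewrite !pnatr_eq0 -!lt0n !fact_gt0.
Qed.

Section laguerre_generating_function.
Context (R : realType).
Implicit Types b z w : R.

(** Row i sums to (-zw)^i/i! (1-w)^(-(b+i+1)) by the binomial series, and the rows add up to an
    exponential series in -zw/(1-w). The majorant is the same expression with |zw|. *)
Lemma laguerre_generating b z w : -1 < b -> 0 <= w < 1 ->
  series (fun k => (laguerre b k).[z] * w ^+ k) @ \oo -->
  (1 - w) `^ (- (b + 1)) * expR (- (z * w / (1 - w))).
Proof.
move=> b1 w01; have /andP[w0 w1] := w01.
have w10 : 0 < 1 - w by rewrite subr_gt0.
have bi i : 0 < b + i.+1%:R.
  by rewrite -natr1 addrCA ltr_wpDl// -ltrBlDr sub0r.
pose a i m : R := (- (z * w)) ^+ i / i`!%:R *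
  (binomial_coeff (b + i.+1%:R) m * w ^+ m).
have -> : (fun k => (laguerre b k).[z] * w ^+ k) =
    (fun k => \sum_(0 <= i < k.+1) a i (k - i)%N).
  apply/funext => k; rewrite laguerre_hornerE mulr_suml.
  apply: eq_big_nat => i /andP[_ ik].
  rewrite /a -{2}(subnKC (n := k) (m := i)) // exprD -mulNr exprMn; ring.
have expand y i : y ^+ i / i`!%:R * (1 - w) `^ (- (b + i.+1%:R)) =
    (1 - w) `^ (- (b + 1)) * exp_coeff (y / (1 - w)) i.
  have -> : - (b + i.+1%:R) = - (b + 1) + - i%:R by rewrite -natr1; ring.
  rewrite /exp_coeff /= powRD; last by rewrite (gt_eqF w10) implybT.
  by rewrite powR_invn ?(ltW w10)// exprMn exprVn; ring.
have cvgE y : series (fun i => y ^+ i / i`!%:R * (1 - w) `^ (- (b + i.+1%:R))) @ \oo -->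
    (1 - w) `^ (- (b + 1)) * expR (y / (1 - w)).
  have -> : series (fun i => y ^+ i / i`!%:R * (1 - w) `^ (- (b + i.+1%:R))) =
      (fun n => (1 - w) `^ (- (b + 1)) * series (exp_coeff (y / (1 - w))) n).
    apply/funext => n; rewrite /series/= mulr_sumr; apply: eq_bigr => i _.
    exact: expand.
  by apply: cvgMr; exact: is_cvg_series_exp_coeff.
apply: (cvg_series_triangle
  (A := fun i => (- (z * w)) ^+ i / i`!%:R * (1 - w) `^ (- (b + i.+1%:R)))
  (B := fun i => `|z * w| ^+ i / i`!%:R * (1 - w) `^ (- (b + i.+1%:R)))).
- move=> i.
  have -> : series (a i) = (fun n => (- (z * w)) ^+ i / i`!%:R *
      series (fun m => binomial_coeff (b + i.+1%:R) m * w ^+ m) n).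
    by apply/funext => n; rewrite /series/= mulr_sumr.
  by apply: cvgMr; exact: binomial_series.
- move=> i M.
  have -> : series (a i) M = (- (z * w)) ^+ i / i`!%:R *
      series (fun m => binomial_coeff (b + i.+1%:R) m * w ^+ m) M.
    by rewrite /series/= mulr_sumr.
  rewrite normrM normf_div normrX normrN [`|i`!%:R|]ger0_norm//.
  rewrite ler_wpM2l ?divr_ge0 ?exprn_ge0// ger0_norm.
    exact: binomial_series_le.
  by apply: sumr_ge0 => m _; rewrite mulr_ge0 ?binomial_coeff_ge0 ?exprn_ge0.
- exact: cvgP (cvgE _).
- by have := cvgE (- (z * w)); rewrite [- _ / _]mulNr.
Qed.

(** For z >= 0 all terms of L_k(-z) are nonnegative and |L_k(z)| <= L_k(-z), so every partial sum
    stays below the full generating function at -z. This is the majorant, uniform in M, for the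
    rearrangement in the Hille-Hardy formula. *)
Lemma laguerre_series_bound b z w M : -1 < b -> 0 <= z -> 0 <= w < 1 ->
  `|series (fun k => (laguerre b k).[z] * w ^+ k) M| <=
  (1 - w) `^ (- (b + 1)) * expR (z * w / (1 - w)).
Proof.
move=> b1 z0 w01; have /andP[w0 w1] := w01.
have bi i : 0 < b + i.+1%:R.
  by rewrite -natr1 addrCA ltr_wpDl// -ltrBlDr sub0r.
have lag_abs k : `|(laguerre b k).[z]| <= (laguerre b k).[- z].
  rewrite !laguerre_hornerE; apply: le_trans (ler_norm_sum _ _ _) _.
  apply: ler_sum => i _; rewrite opprK !normrM normrX normrN normfV.
  by rewrite !ger0_norm ?binomial_coeff_ge0.
have lagN k : 0 <= (laguerre b k).[- z] * w ^+ k.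
  by rewrite mulr_ge0 ?exprn_ge0// (le_trans _ (lag_abs k)).
have -> : z * w / (1 - w) = - (- z * w / (1 - w)) by rewrite !mulNr opprK.
apply: le_trans (series_ge0_le_lim M lagN (laguerre_generating b1 w01)).
rewrite /series/=; apply: le_trans (ler_norm_sum _ _ _) _.
apply: ler_sum => k _; rewrite normrM [`|w ^+ k|]ger0_norm ?exprn_ge0//.
by rewrite ler_wpM2r ?exprn_ge0.
Qed.

End laguerre_generating_function.

(** * Product formula for Laguerre polynomials *)

Section laguerre_polynomials.
Context (R : realType).
Implicit Types (a x y : R) (k n m i : nat) (P Q : {poly R}).

Let laguerre_coef a k i : (laguerre a k)`_i =
  if (i <= k)%N then (-1) ^+ i * pochhammer (a + i.+1%:R) (k - i)
                       / ((k - i)`!%:R * i`!%:R) else 0.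
Proof.
rewrite /laguerre coef_poly ltnS; case: leqP => // ik.
congr (_ * _ / _).
rewrite /pochhammer -{1}[i.+1]add0n big_addn subSS; apply: eq_bigr => m _.
by rewrite natrD [m%:R + _]addrC addrA.
Qed.

Let fact_neq0 n : n`!%:R != 0 :> R.
Proof. by rewrite pnatr_eq0 -lt0n fact_gt0. Qed.

(** Valid for every i: at i = k the factor i - k vanishes, and beyond k both coefficients are 0. *)
Let laguerre_coefS a k i :
  i.+1%:R * (i.+1%:R + a) * (laguerre a k)`_i.+1 =
  (i%:R - k%:R) * (laguerre a k)`_i.
Proof.
rewrite !laguerre_coef; case: (ltngtP i k) => [ik|ki|->].
- have [m ->] : exists m, k = (i + m).+1.
    by exists (k - i.+1)%N; rewrite -addSn subnKC.
  rewrite subSS -addnS !addKn pochhammerSl exprS !factS !natrM !natrD.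
  have -> : a + i.+1%:R + 1 = a + i.+2%:R by rewrite -addrA natr1.
  rewrite -!natr1; field.
  by rewrite !fact_neq0 !natr1 !pnatr_eq0.
- by rewrite !mulr0.
- by rewrite subrr mul0r mulr0.
Qed.

Let laguerre_coef0 a k : (laguerre a k)`_0 = pochhammer (a + 1) k / k`!%:R.
Proof. by rewrite laguerre_coef /= subn0 expr0 mul1r mulr1. Qed.

Let conv_op a k P :=
  'X * deriv (deriv P) + ((a + 1)%:P - 'X) * deriv P + k%:R%:P * P.

Let conv_op_coef a k P i : (conv_op a k P)`_i =
  i.+1%:R * (i.+1%:R + a) * P`_i.+1 - (i%:R - k%:R) * P`_i.
Proof.
rewrite /conv_op !coefD mulrBl coefB !coefCM !coefXM !coef_deriv.
case: i => [|i] /=.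
  by move: P`_1 P`_0 => p1 p0; rewrite mulr1n; ring.
move: P`_i.+2 P`_i.+1 => p2 p1.
have natl (p : R) n : p *+ n = n%:R * p by rewrite mulr_natl.
by rewrite (natl p1) (natl p2) (natl _ i.+1) -!natr1; ring.
Qed.

Lemma laguerre_ode a k :
  'X * deriv (deriv (laguerre a k)) + ((a + 1)%:P - 'X) * deriv (laguerre a k)
    + k%:R%:P * laguerre a k = 0.
Proof.
apply/polyP => i; rewrite coef0 -/(conv_op a k _) conv_op_coef.
by rewrite laguerre_coefS subrr.
Qed.

(** The equation is a two-term recurrence whose leading factor (i+1)(i+1+a) is positive, so the
    constant coefficient determines the rest. The cross-multiplied form avoids dividing by the
    constant coefficient of P, which may vanish. *)
Lemma laguerre_ode_unique a k P : -1 < a ->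
  'X * deriv (deriv P) + ((a + 1)%:P - 'X) * deriv P + k%:R%:P * P = 0 ->
  P`_0 *: laguerre a k = (laguerre a k)`_0 *: P.
Proof.
rewrite -/(conv_op a k _) => a1 /polyP ode; apply/polyP => i; rewrite !coefZ.
elim: i => [|i IH]; first by rewrite mulrC.
have PS : i.+1%:R * (i.+1%:R + a) * P`_i.+1 = (i%:R - k%:R) * P`_i.
  by apply/eqP; rewrite -subr_eq0 -conv_op_coef ode coef0.
have nz : i.+1%:R * (i.+1%:R + a) != 0 :> R.
  rewrite mulf_neq0// gt_eqF// -natr1 -addrA ltr_wpDl// -ltrBlDl sub0r.
  exact: a1.
apply: (mulfI nz); rewrite mulrCA laguerre_coefS mulrCA IH.
by rewrite [RHS]mulrCA PS mulrCA.
Qed.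

(** This combination raises the order by 2 and lowers the degree by 1: exactly the passage from one
    term of the product formula to the next. *)
Lemma laguerre_deriv2_sub_deriv a k :
  deriv (deriv (laguerre a k)) - deriv (laguerre a k) =
  if k is m.+1 then laguerre (a + 2) m else 0.
Proof.
case: k => [|m]; apply/polyP => i; rewrite coefB !coef_deriv !laguerre_coef.
  by rewrite coef0 /= !mul0rn subrr.
rewrite -[_ *+ i.+2]mulr_natl -[_ *+ i.+1]mulr_natl -[X in _ - X]mulr_natl.
case: (ltngtP i m) => [im|mi|->].
- have [p ->] : exists p, m = (i + p).+1.
    by exists (m - i.+1)%N; rewrite -addSn subnKC.
  have e : ((i + p).+1 - i)%N = p.+1 by rewrite subSn ?leq_addr// addKn.
  rewrite !ltnS leq_addr (leqW (leq_addr p i)) /= !subSS e addKn !factS !natrM.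
  have -> : a + 2 + i.+1%:R = a + i.+3%:R by rewrite -!natr1; ring.
  rewrite (pochhammerSl (a + i.+2%:R)) (pochhammerS (a + i.+3%:R)) !exprS.
  have -> : a + i.+2%:R + 1 = a + i.+3%:R by rewrite -addrA natr1.
  rewrite -!natr1; field.
  by rewrite !fact_neq0 !natr1 !pnatr_eq0.
- have -> : (i.+2 <= m.+1)%N = false by rewrite ltnS ltnNge ltnW.
  have -> : (i.+1 <= m.+1)%N = false by rewrite ltnS leqNgt mi.
  by rewrite !mulr0 subrr.
- have -> : (m.+2 <= m.+1)%N = false by rewrite ltnn.
  rewrite leqnn subSS subnn /pochhammer !big_nil !factS exprS !natrM -!natr1.
  by field; rewrite !fact_neq0 !natr1 !pnatr_eq0.
Qed.

Let shifted a y k n :=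
  (y%:P * 'X) ^+ n * (laguerre (a + (2 * n)%:R) (k - n) \Po ('X + y%:P)).

(** The image has one piece with (yX)^(n-1) and one with (yX)^n. The first piece of term n + 1
    contains the same power and the same Laguerre polynomial as the second piece of term n, which
    prepares a telescoping sum. *)
Let conv_op_shifted a y k n : (n <= k)%N ->
  conv_op a k (shifted a y k n) =
  y%:P * ((n%:R * (n%:R + a))%:P * ((y%:P * 'X) ^+ n.-1 *
          (laguerre (a + (2 * n)%:R) (k - n) \Po ('X + y%:P)))
        - (y%:P * 'X) ^+ n *
          (if (k - n)%N is m.+1 then laguerre (a + (2 * n)%:R + 2) m \Po ('X + y%:P) else 0)).
Proof.
move=> nk; rewrite /conv_op /shifted.
have := laguerre_deriv2_sub_deriv (a + (2 * n)%:R) (k - n).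
have := laguerre_ode (a + (2 * n)%:R) (k - n).
set Q := laguerre _ _; set Z := 'X + y%:P => ode.
have -> : (if (k - n)%N is m.+1 then laguerre (a + (2 * n)%:R + 2) m \Po Z else 0) =
   (if (k - n)%N is m.+1 then laguerre (a + (2 * n)%:R + 2) m else 0) \Po Z.
  by case: (k - n)%N => //; rewrite comp_poly0.
move=> <-.
have {ode} := congr1 (fun p => p \Po Z) ode.
rewrite comp_poly0 !comp_polyB !comp_polyD !comp_polyM !comp_polyB !comp_polyC !comp_polyX.
have dZ : deriv Z = 1 by rewrite /Z derivD derivX derivC addr0.
set W := y%:P * 'X.
have dW i : deriv (W ^+ i) = i%:R%:P * (y%:P * W ^+ i.-1).
  rewrite deriv_exp /W derivM derivC derivX mul0r add0r mulr1 -mulr_natl.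
  by rewrite polyC_natr; ring.
have -> : deriv (deriv (W ^+ n * (Q \Po Z))) =
   n%:R%:P * n.-1%:R%:P * y%:P ^+ 2 * W ^+ n.-2 * (Q \Po Z)
   + (n%:R + n%:R)%:P * y%:P * W ^+ n.-1 * (deriv Q \Po Z)
   + W ^+ n * (deriv (deriv Q) \Po Z).
  clearbody W Z; rewrite !(derivM, derivD, dW, derivC, deriv_comp, dZ, mulr1).
  rewrite polyCD; move: (Q \Po Z) (deriv Q \Po Z) (deriv (deriv Q) \Po Z).
  by move: (W ^+ n.-2) (W ^+ n.-1) (W ^+ n) => w2 w1 w0 q0 q1 q2; ring.
rewrite (derivM (W ^+ n)) dW deriv_comp dZ mulr1.
set Q0 := Q \Po Z; set Q1 := deriv Q \Po Z; set Q2 := deriv (deriv Q) \Po Z.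
have -> : k%:R = (k - n)%:R + n%:R :> R by rewrite -natrD subnK.
rewrite mulnC muln2 -addnn natrD !(polyCD, polyCM) => ode.
(* The two sides differ by (yX)^n times the Laguerre equation of order a + 2n and degree k - n,
   evaluated at X + y. *)
apply/eqP; rewrite -subr_eq0 -[X in _ == X](mulr0 (W ^+ n)) -ode; apply/eqP.
clear ode dW dZ nk; clearbody Q0 Q1 Q2; clear Q; rewrite /Z /W {W Z}.
move: (k - n)%N (y%:P) ('X) (a%:P) => m Y X A.
(* The exponents [n.-1] and [n.-2] truncate, so n = 0 and n = 1 are treated apart. *)
case: n => [|[|n]] /=; rewrite -?natr1 ?(polyCD, polyC1) !exprS; move: (m%:R%:P) => M.
- by rewrite polyC0 expr0; ring.
- by rewrite polyC0 expr0; ring.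
- by move: (n%:R%:P) ((Y * X) ^+ n) => N Wn; ring.
Qed.

Let hh_coef a n : R := (n`!%:R * pochhammer (a + 1) n)^-1.

Let hh_coefS a n : -1 < a ->
  hh_coef a n.+1 * (n.+1%:R * (n.+1%:R + a)) = hh_coef a n.
Proof.
move=> a1; have a10 : 0 < a + 1 by rewrite -ltrBlDr sub0r.
rewrite /hh_coef factS natrM pochhammerS.
have -> : a + 1 + n%:R = n.+1%:R + a by rewrite -natr1; ring.
have h1 : n.+1%:R + a != 0.
  by rewrite gt_eqF// -natr1 -addrA ltr_wpDl// addrC.
have h2 : n.+1%:R != 0 :> R by rewrite pnatr_eq0.
have h3 : pochhammer (a + 1) n != 0 by rewrite gt_eqF// pochhammer_gt0.
move: n.+1%:R h1 h2 (pochhammer (a + 1) n) h3 => N h1 h2 p h3.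
by field; rewrite h3 fact_neq0 h1 h2.
Qed.

Lemma laguerre_product a k x y : -1 < a ->
  k`!%:R / pochhammer (a + 1) k * (laguerre a k).[x] * (laguerre a k).[y] =
  \sum_(0 <= n < k.+1) (x * y) ^+ n / (n`!%:R * pochhammer (a + 1) n)
    * (laguerre (a + (2 * n)%:R) (k - n)).[x + y].
Proof.
move=> a1; have a10 : 0 < a + 1 by rewrite -ltrBlDr sub0r.
pose W := y%:P * 'X : {poly R}; pose Z := 'X + y%:P : {poly R}.
pose P := \sum_(0 <= n < k.+1) (hh_coef a n)%:P * shifted a y k n.
pose u n := (hh_coef a n)%:P * (W ^+ n *
  (if (k - n)%N is m.+1 then laguerre (a + (2 * n)%:R + 2) m \Po Z else 0)).
have opD p q : conv_op a k (p + q) = conv_op a k p + conv_op a k q.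
  by rewrite /conv_op !derivD; move: (deriv _) (deriv _) (deriv _) (deriv _) => *; ring.
have opC c p : conv_op a k (c%:P * p) = c%:P * conv_op a k p.
  rewrite /conv_op !mul_polyC !derivZ -!mul_polyC.
  by move: (deriv p) (deriv (deriv p)) => p1 p2; ring.
have op0 : conv_op a k 0 = 0 by rewrite /conv_op !linear0 !mulr0 !addr0.
(* By [hh_coefS] the weights make neighbouring pieces cancel; only the second piece of the last term
   remains, and for N = k it is 0. *)
have tele N : (N <= k)%N -> conv_op a k (\sum_(0 <= n < N.+1)
    (hh_coef a n)%:P * shifted a y k n) = - (y%:P * u N).
  elim: N => [|N IH] Nk.
    rewrite big_nat1 opC conv_op_shifted// mulr0n mul0r polyC0 mul0r sub0r.
    by rewrite /u -/W -/Z; move: (W ^+ 0 * _) => p; ring.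
  rewrite big_nat_recr//= opD opC IH ?(ltnW Nk)// conv_op_shifted//= -/W -/Z.
  have -> : u N = (hh_coef a N)%:P *
      (W ^+ N * (laguerre (a + (2 * N.+1)%:R) (k - N.+1) \Po Z)).
    have -> : a + (2 * N.+1)%:R = a + (2 * N)%:R + 2.
      by rewrite mulnS natrD [2%:R + _]addrC addrA.
    by rewrite /u subnS; case: (k - N)%N (subn_gt0 N k) => [|m]//; rewrite Nk.
  rewrite -(hh_coefS N a1) /u polyCM.
  move: (W ^+ N * _) (W ^+ N.+1 * _) => p q.
  by move: (hh_coef a N.+1)%:P (N.+1%:R * (N.+1%:R + a))%:P => c d; ring.
have opP : conv_op a k P = 0 by rewrite tele// /u subnn !mulr0 oppr0.
(* At x = 0 only n = 0 survives. Since L_k^a(0) = (a+1)_k/k!, this is also the origin of the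
   prefactor k!/(a+1)_k. *)
have P0 : P`_0 = (laguerre a k).[y].
  rewrite -horner_coef0 /P horner_sum big_nat_recl// big1_seq ?addr0; last first.
    move=> n _; rewrite /shifted 2!hornerM horner_exp hornerM hornerX mulr0.
    by rewrite expr0n mul0r mulr0.
  rewrite /shifted hornerM hornerC expr0 mul1r horner_comp hornerD hornerX hornerC.
  by rewrite add0r muln0 addr0 subn0 /hh_coef /pochhammer big_nil fact0 mulr1 invr1 mul1r.
have := laguerre_ode_unique a1 opP; rewrite P0 laguerre_coef0.
move=> /(congr1 (fun p => p.[x])); rewrite !hornerZ => E.
have pk : pochhammer (a + 1) k != 0 by rewrite gt_eqF// pochhammer_gt0.
rewrite -mulrA [(laguerre a k).[x] * _]mulrC E mulrA mulf_div.
rewrite [pochhammer _ _ * k`!%:R]mulrC divff ?mul1r; last first.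
  by rewrite mulf_neq0// fact_neq0.
rewrite /P horner_sum; apply: eq_bigr => n _.
rewrite /shifted hornerM hornerC hornerM horner_exp hornerM hornerC hornerX.
rewrite horner_comp hornerD hornerX hornerC /hh_coef [y * x]mulrC.
by rewrite mulrA [_^-1 * _]mulrC.
Qed.

End laguerre_polynomials.

(** * Hille-Hardy formula *)

Definition bessel_coeff (R : realType) (a : R) (n : nat) : R :=
  (n`!%:R * pochhammer (a + 1) n)^-1.

(** The hypergeometric function 0F1(; a+1; s): I_a(x) is (x/2)^a / Gamma(a+1) times its value at s =
    x^2/4. *)
Definition bessel_series (R : realType) (a s : R) : R :=
  limn (pseries (bessel_coeff a) s).

Section bessel_series.
Context (R : realType) (a : R).
Context (a1 : -1 < a).

Let a10 : 0 < a + 1. Proof. by rewrite -ltrBlDr sub0r. Qed.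

Lemma bessel_coeff_ge0 n : 0 <= bessel_coeff a n.
Proof. by rewrite invr_ge0 mulr_ge0// ltW// pochhammer_gt0. Qed.

Lemma bessel_coeff_le n : bessel_coeff a n <= (n`!%:R * (a + 1) ^+ n)^-1.
Proof.
have f0 : 0 < n`!%:R :> R by rewrite ltr0n fact_gt0.
rewrite lef_pV2 ?posrE ?mulr_gt0 ?exprn_gt0 ?pochhammer_gt0//.
rewrite ler_pM2l//; elim: n {f0} => [|n IH]; first by rewrite /pochhammer big_nil.
rewrite exprSr pochhammerS; apply: ler_pM => //.
- by rewrite exprn_ge0// ltW.
- exact: ltW.
- by rewrite lerDl.
Qed.

Lemma is_cvg_bessel_series s : cvgn (pseries (bessel_coeff a) s).
Proof.
apply: normed_cvg.
apply: (@series_le_cvg _ _ (exp_coeff (`|s| / (a + 1)))) => [n|n|n|].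
- exact: normr_ge0.
- by rewrite exp_coeff_ge0// divr_ge0// ltW.
- rewrite /= normrM normrX ger0_norm ?bessel_coeff_ge0// /exp_coeff/=.
  apply: (@le_trans _ _ ((n`!%:R * (a + 1) ^+ n)^-1 * `|s| ^+ n)).
    by rewrite ler_wpM2r ?exprn_ge0// bessel_coeff_le.
  by rewrite invfM exprMn exprVn mulrC mulrA mulrAC.
- exact: is_cvg_series_exp_coeff.
Qed.

Lemma hille_hardy w x y : 0 <= w < 1 -> 0 <= x -> 0 <= y ->
  series (fun k => k`!%:R / pochhammer (a + 1) k * (laguerre a k).[x]
                   * (laguerre a k).[y] * w ^+ k) @ \oo -->
  (1 - w) `^ (- (a + 1)) * expR (- ((x + y) * w / (1 - w)))
  * bessel_series a (x * y * w / (1 - w) ^+ 2).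
Proof.
move=> w01 x0 y0; have /andP[w0 w1] := w01.
have w10 : 0 < 1 - w by rewrite subr_gt0.
set s := x * y * w / (1 - w) ^+ 2.
have s0 : 0 <= s by rewrite divr_ge0 ?exprn_ge0 ?(ltW w10)// !mulr_ge0.
have an n : -1 < a + (2 * n)%:R by rewrite (lt_le_trans a1)// lerDl.
(* Up to its coefficient, the sum of row n; the extra (1-w)^(-2n) turns (xyw)^n into s^n. It is used
   with z = -(x+y)w/(1-w) for the limit and with -z for the majorant. *)
pose c n (z : R) : R := (1 - w) `^ (- (a + (2 * n)%:R + 1)) * expR z.
pose t n m : R := (x * y * w) ^+ n * bessel_coeff a n *
  ((laguerre (a + (2 * n)%:R) m).[x + y] * w ^+ m).
have -> : (fun k => k`!%:R / pochhammer (a + 1) k * (laguerre a k).[x]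
      * (laguerre a k).[y] * w ^+ k) =
    (fun k => \sum_(0 <= n < k.+1) t n (k - n)%N).
  apply/funext => k; rewrite laguerre_product// mulr_suml.
  apply: eq_big_nat => n /andP[_ nk].
  have -> : w ^+ k = w ^+ n * w ^+ (k - n) by rewrite -exprD subnKC.
  rewrite /t [(x * y * w) ^+ n]exprMn.
  by rewrite /bessel_coeff; ring.
have expand n z : (x * y * w) ^+ n * bessel_coeff a n * c n z =
    (1 - w) `^ (- (a + 1)) * expR z * (bessel_coeff a n * s ^+ n).
  rewrite /c; have -> : - (a + (2 * n)%:R + 1) = - (a + 1) + - (2 * n)%:R by ring.
  rewrite powRD; last by rewrite (gt_eqF w10) implybT.
  rewrite powR_invn ?(ltW w10)// /s exprM expr_div_n.
  by ring.
have cvgE z : series (fun n => (x * y * w) ^+ n * bessel_coeff a n * c n z) @ \oo -->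
    (1 - w) `^ (- (a + 1)) * expR z * bessel_series a s.
  have -> : series (fun n => (x * y * w) ^+ n * bessel_coeff a n * c n z) =
      (fun N => (1 - w) `^ (- (a + 1)) * expR z * pseries (bessel_coeff a) s N).
    apply/funext => N; rewrite /pseries /series/= mulr_sumr.
    by apply: eq_bigr => n _; exact: expand.
  by apply: cvgMr; exact: is_cvg_bessel_series.
have tE n : series (t n) = (fun M => (x * y * w) ^+ n * bessel_coeff a n *
    series (fun m => (laguerre (a + (2 * n)%:R) m).[x + y] * w ^+ m) M).
  by apply/funext => M; rewrite /series/= mulr_sumr.
apply: (cvg_series_triangle
  (A := fun n => (x * y * w) ^+ n * bessel_coeff a n * c n (- ((x + y) * w / (1 - w))))
  (B := fun n => (x * y * w) ^+ n * bessel_coeff a n * c n ((x + y) * w / (1 - w)))).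
- by move=> n; rewrite tE; apply: cvgMr; apply: laguerre_generating.
- move=> n M; rewrite tE normrM ger0_norm; last first.
    by rewrite mulr_ge0 ?bessel_coeff_ge0// exprn_ge0// !mulr_ge0.
  rewrite ler_wpM2l ?mulr_ge0 ?bessel_coeff_ge0 ?exprn_ge0 ?mulr_ge0//.
  by apply: laguerre_series_bound => //; exact: addr_ge0.
- exact: cvgP (cvgE _).
- exact: cvgE.
Qed.

End bessel_series.

(** * Functional equation of the Gamma function *)

Section gamma_functional_equation.
Context (R : realType).
Implicit Types (a x : R) (n : nat).
Notation mu := (@lebesgue_measure R).

Let integrand a x : R := x `^ (a - 1) * expR (- x).
Let primitive a x : R := x `^ a * expR (- x).
Let box n : set R := `[n.+1%:R^-1, n.+1%:R].

Let is_derive_primitive a x : 0 < x ->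
  is_derive x 1 (primitive a) (a * integrand a x - integrand (a + 1) x).
Proof.
move=> x0.
have H : is_derive x 1 (fun y : R => - y) (-1).
  have -> : (fun y : R => - y) = (fun y => -1 * y + 0).
    by apply/funext => y; rewrite mulN1r addr0.
  exact: is_derive_affine.
apply: (is_derive_eq (is_deriveM_fun (is_derive_powR a x0) (is_derive_expR_comp H))).
by rewrite /integrand addrK; ring.
Qed.

Let continuous_integrand a x : 0 < x -> {for x, continuous (integrand a)}.
Proof. by move=> x0; exact: is_derive_continuous (is_derive_primitive _ x0). Qed.

Let box_pos n x : x \in box n -> 0 < x.
Proof.
rewrite inE /box/= in_itv/= => /andP[+ _]; apply: lt_le_trans.
by rewrite invr_gt0 ltr0n.
Qed.

Let continuous_box n (f : R -> R) :
  (forall x, 0 < x -> {for x, continuous f}) -> {within box n, continuous f}.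
Proof.
by move=> cf; apply: continuous_in_subspaceT => x /box_pos x0; exact: cf.
Qed.

Let integrable_box n a : mu.-integrable (box n) (EFin \o integrand a).
Proof.
apply: continuous_compact_integrable; first exact: segment_compact.
by apply: continuous_box => x; exact: continuous_integrand.
Qed.

(** Integration by parts between 1/(n+1) and n + 1, where the integrands are continuous; the boxes
    increase to (0,oo). *)
Let box_integral n a :
  (\int[mu]_(x in box n) (a%:E * (integrand a x)%:E) =
   \int[mu]_(x in box n) (integrand (a + 1) x)%:E +
     (primitive a n.+1%:R - primitive a n.+1%:R^-1)%:E)%E.
Proof.
(* For n = 0 the box is the single point 1, and the integrals and the boundary term are all 0. *)
have [n0|n0] := eqVneq n 0%N.
  rewrite n0 /box invr1 set_itv1 !integral_set1 subrr adde0 //.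
have lt : n.+1%:R^-1 < n.+1%:R :> R.
  rewrite invf_plt ?posrE ?ltr0n// -invr1.
  apply: (@lt_le_trans _ _ 1).
    by rewrite invr1 invf_lt1 ?ltr0n// ltr1n ltnS lt0n.
  by rewrite invr1 ler1n.
have pos x : n.+1%:R^-1 <= x -> 0 < x.
  by apply: lt_le_trans; rewrite invr_gt0 ltr0n.
have cP x : 0 < x -> {for x, continuous (primitive a)}.
  by move=> x0; exact: is_derive_continuous (is_derive_primitive a x0).
have ftc : (\int[mu]_(x in box n) (a * integrand a x - integrand (a + 1) x)%:E =
    (primitive a n.+1%:R)%:E - (primitive a n.+1%:R^-1)%:E)%E.
  apply: continuous_FTC2 => //.
  - apply: continuous_box => x x0.
    apply: (@continuousB _ _ _ (fun y => a * integrand a y)).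
      apply: continuousM; first exact: cst_continuous.
      exact: continuous_integrand.
    exact: continuous_integrand.
  - split.
    + move=> x; rewrite in_itv/= => /andP[/ltW/pos x0 _].
      by have H := is_derive_primitive a x0; exact: ex_derive.
    + exact/cvg_at_right_filter/cP/pos.
    + exact/cvg_at_left_filter/cP/pos/ltW.
  - move=> x; rewrite in_itv/= => /andP[/ltW/pos x0 _].
    by rewrite derive1E; have H := is_derive_primitive a x0; exact: derive_val.
have mbox : measurable (box n) by exact: measurable_itv.
move: ftc; under eq_integral do rewrite EFinB EFinM.
have ia : mu.-integrable (box n) (fun x => a%:E * (integrand a x)%:E)%E.
  by apply: integrableZl => //; exact: integrable_box.
have -> : (\int[mu]_(x in box n) (a%:E * (integrand a x)%:E -
      (integrand (a + 1) x)%:E) =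
    \int[mu]_(x in box n) (a%:E * (integrand a x)%:E) -
    \int[mu]_(x in box n) (integrand (a + 1) x)%:E)%E.
  by apply: integralB => //; exact: integrable_box.
have fin : (\int[mu]_(x in box n) (integrand (a + 1) x)%:E)%E \is a fin_num.
  by apply: integrable_fin_num => //; exact: integrable_box.
by rewrite -EFinB => H; rewrite -[LHS](subeK _ fin) H addeC.
Qed.

Let box_bigcup : \bigcup_n box n = `]0, +oo[%classic.
Proof.
apply/seteqP; split => x /=.
  by move=> [n _ /mem_set/box_pos x0]; rewrite in_itv/= x0.
rewrite ?in_itv/= ?andbT => x0; exists (Num.truncn (x + x^-1)) => //=.
have xV0 : 0 < x^-1 by rewrite invr_gt0.
have xx : x + x^-1 < (Num.truncn (x + x^-1)).+1%:R.
  by apply: truncnS_gt; rewrite addr_ge0// ltW.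
rewrite /box/= ?in_itv/=; apply/andP; split.
  rewrite invf_ple ?posrE ?ltr0n//; apply: le_trans (ltW xx).
  by rewrite lerDr ltW.
by apply: le_trans (ltW xx); rewrite lerDl ltW.
Qed.

Let cvg_box_integral a :
  (\int[mu]_(x in box n) (integrand a x)%:E @[n --> \oo] -->
   \int[mu]_(x in `]0%R, +oo[) (integrand a x)%:E)%E.
Proof.
rewrite -box_bigcup; apply: ge0_nondecreasing_set_cvg_integral.
- move=> m n mn; apply/subsetPset => x /=; rewrite /box/= ?in_itv/= => /andP[h1 h2].
  apply/andP; split; last by apply: le_trans h2 _; rewrite ler_nat.
  by apply: le_trans h1; rewrite lef_pV2 ?posrE ?ltr0n// ler_nat.
- by move=> n; exact: measurable_itv.
- by move=> n; exact: measurable_int (integrable_box n a).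
- by move=> n x _; rewrite lee_fin mulr_ge0 ?powR_ge0 ?expR_ge0.
Qed.

Let cvg_primitive_pinfty a : (fun n => primitive a n.+1%:R) @ \oo --> 0.
Proof.
(* With N >= a and x = n + 1, exp x >= x^(N+1)/(N+1)! gives x^a exp(-x) <= (N+1)!/x. *)
pose N := (Num.truncn `|a|).+1.
have aN : a <= N%:R.
  by apply: le_trans (ler_norm a) _; exact/ltW/truncnS_gt.
apply: (@squeeze_cvgr _ _ _ _ (cst 0)
  (fun n => N.+1`!%:R * @harmonic R n)).
- near=> n; apply/andP; split; first by rewrite mulr_ge0 ?powR_ge0 ?expR_ge0.
  rewrite /primitive expRN.
  have n0 : 0 < n.+1%:R :> R by rewrite ltr0n.
  rewrite /harmonic/= ler_pdivlMr// mulrAC ler_pdivrMr ?expR_gt0//.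
  apply: (@le_trans _ _ (n.+1%:R ^+ N.+1)).
    rewrite exprSr ler_wpM2r// -powR_mulrn ?ler0n//.
    by apply: ler_powR => //; rewrite ler1n.
  rewrite -ler_pdivrMl ?ltr0n ?fact_gt0// mulrC.
  by apply: le_trans (expR_ge1Dxn N (ltW n0)); rewrite lerDr.
- exact: cvg_cst.
- rewrite (_ : nbhs (0 : R) = nbhs (N.+1`!%:R * 0 : R)); last by rewrite mulr0.
  by apply: cvgMr; exact: cvg_harmonic.
Unshelve. all: by end_near. Qed.

Let cvg_primitive0 a : 0 < a -> (fun n => primitive a n.+1%:R^-1) @ \oo --> 0.
Proof.
move=> a0.
apply: (@squeeze_cvgr _ _ _ _ (cst 0) (fun n => (@harmonic R n) `^ a)).
- near=> n; apply/andP; split; first by rewrite mulr_ge0 ?powR_ge0 ?expR_ge0.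
  rewrite /primitive /harmonic/= -[leRHS]mulr1.
  by rewrite ler_wpM2l ?powR_ge0// expR_le1 oppr_le0 invr_ge0.
- exact: cvg_cst.
- move: (powR_cvg0 a0) => /cvg_at_rightP; apply; split => [n|].
    exact: harmonic_gt0.
  exact: cvg_harmonic.
Unshelve. all: by end_near. Qed.

(** Turns the ratio Gamma(k+1)/Gamma(k+alpha+1) in the normalization of the Laguerre functions into
    k!/(alpha+1)_k, up to a constant independent of k. *)
Lemma GammaS a : 0 < a -> Gamma (a + 1) = a * Gamma a.
Proof.
move=> a0; rewrite /Gamma /Rintegral.
have E : (a%:E * \int[mu]_(x in `]0%R, +oo[) (integrand a x)%:E =
    \int[mu]_(x in `]0%R, +oo[) (integrand (a + 1) x)%:E)%E.
  have L := cvgeZl (y := a%:E) isT (@cvg_box_integral a).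
  have D : (primitive a n.+1%:R - primitive a n.+1%:R^-1)%:E @[n --> \oo] --> 0%:E.
    apply: cvg_EFin; first by near=> n.
    rewrite -[X in _ --> X](subr0 0).
    exact: cvgB (@cvg_primitive_pinfty a) (@cvg_primitive0 a a0).
  have Rr : (\int[mu]_(x in box n) (integrand (a + 1) x)%:E +
     (primitive a n.+1%:R - primitive a n.+1%:R^-1)%:E @[n --> \oo] -->
     \int[mu]_(x in `]0%R, +oo[) (integrand (a + 1) x)%:E + 0)%E.
    apply: cvgeD => //; exact: fin_num_adde_defl.
  rewrite adde0 in Rr; apply: (cvg_unique _ _ Rr) => //.
  apply: cvg_trans L; apply: near_eq_cvg; near=> n.
  rewrite -box_integral integralZl//; first exact: measurable_itv.
  exact: integrable_box.
move: E; rewrite /integrand => <-.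
(* The identity was proved in the extended reals; on passing to real values an infinite integral
   reads as 0 on both sides. *)
case: (X in (_ * X)%E) => [r| |] /=; first by [].
- by rewrite gt0_muley ?lte_fin// mulr0.
- by rewrite gt0_muleNy ?lte_fin// mulr0.
Unshelve. all: by end_near. Qed.

Lemma Gamma_ge0 a : 0 <= Gamma a.
Proof. by apply: Rintegral_ge0 => x _; rewrite mulr_ge0 ?powR_ge0 ?expR_ge0. Qed.

End gamma_functional_equation.

(** * Closed form of the heat kernel *)

Definition sinh2 (R : realType) (t : R) : R := (expR (2 * t) - expR (- (2 * t))) / 2.

Definition tanh (R : realType) (t : R) : R :=
  (1 - expR (- (2 * t))) / (1 + expR (- (2 * t))).

(* [sqrt x * exp (- x) * I_alpha x], up to a constant factor *)
Definition bessel_profile (R : realType) (alpha x : R) : R :=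
  x `^ (alpha + 1 / 2) * (expR (- x) * bessel_series alpha (x ^+ 2 / 4)).

Section closed_form.
Context (R : realType) (alpha : R).
Context (alpha1 : -1 < alpha).
Implicit Types (t u v : R) (k : nat).

Lemma sinh2E t : sinh2 t =
  (1 - expR (- (2 * t)) ^+ 2) / (2 * expR (- (2 * t))).
Proof.
rewrite /sinh2 expRN; have := expR_gt0 (2 * t); move: (expR _) => e e0.
by field; rewrite gt_eqF.
Qed.

Lemma sinh2_gt0 t : 0 < t -> 0 < sinh2 t.
Proof.
move=> t0; rewrite divr_gt0// subr_gt0 ltr_expR; lra.
Qed.

Let r k : R := 2 * Gamma (k%:R + 1) / Gamma (k%:R + alpha + 1).

Let rE k : r k = r 0%N * (k`!%:R / pochhammer (alpha + 1) k).
Proof.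
elim: k => [|k IH].
  by rewrite fact0 /pochhammer big_nil divr1 mulr1.
have k1 : 0 < k%:R + 1 :> R by rewrite ltr_wpDl.
have ka : 0 < k%:R + alpha + 1.
  by rewrite -addrA ltr_wpDl// -ltrBlDr sub0r.
have -> : r k.+1 = r k * ((k%:R + 1) / (k%:R + alpha + 1)).
  rewrite /r -[k.+1%:R]natr1.
  have -> : k%:R + 1 + alpha + 1 = k%:R + alpha + 1 + 1 :> R by ring.
  rewrite (GammaS k1) (GammaS ka) invfM; ring.
rewrite IH factS pochhammerS natrM -[k.+1%:R]natr1 -!mulrA; congr (_ * _).
by rewrite !invfM [alpha + 1 + _]addrC addrA; ring.
Qed.

Let r_ge0 k : 0 <= r k.
Proof. by rewrite divr_ge0 ?mulr_ge0 ?Gamma_ge0. Qed.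

(** With q = exp(-2t) and w = q^2 one has 1 - w = 2 s q, so the prefactor of the Hille-Hardy formula
    becomes a power of s and its Bessel argument (uv/s)^2/4. What remains is an identity between
    exponents linear in ln u, ln v and ln s. *)
Lemma heat_kernelE : {c : R | 0 <= c & forall t u v, 0 < t -> 0 < u -> 0 < v ->
  heat_kernel alpha t u v =
  c * sinh2 t `^ (- (1 / 2)) * (bessel_profile alpha (u * v / sinh2 t)
    * expR (- ((u - v) ^+ 2 / (2 * sinh2 t) + tanh t * (u ^+ 2 + v ^+ 2) / 2)))}.
Proof.
exists (r 0%N * 2 `^ (- (alpha + 1))); first by rewrite mulr_ge0 ?powR_ge0.
move=> t u v t0 u0 v0; set q := expR (- (2 * t)); set s := sinh2 t.
have s0 : 0 < s by exact: sinh2_gt0.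
have q0 : 0 < q by exact: expR_gt0.
have q1 : q < 1 by rewrite expR_lt1 oppr_lt0; lra.
have sE : s = (1 - q ^+ 2) / (2 * q) by exact: sinh2E.
clearbody s.
have lnq : ln q = - (2 * t) by rewrite /q expRK.
have wE : expR (- t * 4) = q ^+ 2 by rewrite -expRM_natr; congr expR; ring.
have q2 : 0 < 1 - q ^+ 2 by rewrite subr_gt0 expr_lt1// ltW.
pose K := expR (- t * (2 * alpha + 2)) * r 0%N
  * (u `^ (alpha + 1 / 2) * v `^ (alpha + 1 / 2))
  * (expR (- (u ^+ 2) / 2) * expR (- (v ^+ 2) / 2)).
have term k : expR (- t * (4 * k%:R + 2 * alpha + 2)) * laguerre_fun alpha k u
      * laguerre_fun alpha k v =
    K * (k`!%:R / pochhammer (alpha + 1) k * (laguerre alpha k).[u ^+ 2]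
         * (laguerre alpha k).[v ^+ 2] * (q ^+ 2) ^+ k).
  have -> : expR (- t * (4 * k%:R + 2 * alpha + 2)) =
      expR (- t * (2 * alpha + 2)) * (q ^+ 2) ^+ k.
    by rewrite -wE -expRM_natr -expRD; congr expR; ring.
  rewrite /laguerre_fun -/(r k) /K.
  have sq : Num.sqrt (r k) * Num.sqrt (r k) = r 0%N * (k`!%:R / pochhammer (alpha + 1) k).
    by rewrite -expr2 sqr_sqrtr// rE.
  transitivity (expR (- t * (2 * alpha + 2)) * (q ^+ 2) ^+ k
    * (Num.sqrt (r k) * Num.sqrt (r k))
    * ((laguerre alpha k).[u ^+ 2] * expR (- u ^+ 2 / 2) * u `^ (alpha + 1 / 2))
    * ((laguerre alpha k).[v ^+ 2] * expR (- v ^+ 2 / 2) * v `^ (alpha + 1 / 2))).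
    by ring.
  by rewrite sq; ring.
have H := @hille_hardy R alpha alpha1 (q ^+ 2) (u ^+ 2) (v ^+ 2).
have w01 : 0 <= q ^+ 2 < 1 by rewrite exprn_ge0 ?(ltW q0)//= -subr_gt0.
have {}H := H w01 (sqr_ge0 u) (sqr_ge0 v).
rewrite /heat_kernel (_ : (fun k => _) = (fun k => K * (k`!%:R / pochhammer (alpha + 1) k
    * (laguerre alpha k).[u ^+ 2] * (laguerre alpha k).[v ^+ 2] * (q ^+ 2) ^+ k))); last first.
  by apply/funext => k; exact: term.
rewrite (_ : series _ = (fun N => K * series (fun k => k`!%:R / pochhammer (alpha + 1) k
    * (laguerre alpha k).[u ^+ 2] * (laguerre alpha k).[v ^+ 2] * (q ^+ 2) ^+ k) N)); last first.
  by apply/funext => N; rewrite /series/= mulr_sumr.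
rewrite (cvg_lim _ (cvgMr H))//.
have -> : u ^+ 2 * v ^+ 2 * q ^+ 2 / (1 - q ^+ 2) ^+ 2 = (u * v / s) ^+ 2 / 4.
  by rewrite sE; field; rewrite !gt_eqF.
rewrite /bessel_profile; move: (bessel_series _ _) => B.
have powE x b : 0 < x -> x `^ b = expR (b * ln x) by move=> x0; rewrite /powR gt_eqF.
have ln1w : ln (1 - q ^+ 2) = ln 2 + ln s - 2 * t.
  have -> : 1 - q ^+ 2 = 2 * s * q by rewrite sE; field; rewrite gt_eqF.
  by rewrite !lnM ?posrE ?mulr_gt0// lnq.
have lnx : ln (u * v / s) = ln u + ln v - ln s.
  by rewrite ln_div ?posrE ?mulr_gt0// lnM.
rewrite /K !powE ?divr_gt0 ?mulr_gt0// lnx ln1w.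
transitivity (r 0%N * B * expR (- t * (2 * alpha + 2) + (alpha + 1 / 2) * ln u
   + (alpha + 1 / 2) * ln v + - u ^+ 2 / 2 + - v ^+ 2 / 2
   + - (alpha + 1) * (ln 2 + ln s - 2 * t)
   + - ((u ^+ 2 + v ^+ 2) * q ^+ 2 / (1 - q ^+ 2)))).
  by rewrite !expRD; ring.
transitivity (r 0%N * B * expR (- (alpha + 1) * ln 2 + - (1 / 2) * ln s
   + (alpha + 1 / 2) * (ln u + ln v - ln s) + - (u * v / s)
   + - ((u - v) ^+ 2 / (2 * s) + tanh t * (u ^+ 2 + v ^+ 2) / 2))); last first.
  by rewrite !expRD; ring.
congr (_ * expR _); rewrite /tanh -/q sE; field.
by rewrite !gt_eqF// addr_gt0.
Qed.

End closed_form.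

(** * Chains of derivatives *)

(** Successive derivatives on (0,oo) are carried as explicit functions, so that formulas and bounds
    concern the f i; [derive1n] is met only when a chain is finally applied to the kernel. *)
Definition chain (R : realType) (n : nat) (f : nat -> R -> R) : Prop :=
  forall i, (i < n)%N -> forall x : R, 0 < x -> is_derive x 1 (f i) (f i.+1 x).

Definition leibniz (R : realType) (f g : nat -> R -> R) (m : nat) (x : R) : R :=
  \sum_(0 <= i < m.+1) 'C(m, i)%:R * (f i x * g (m - i)%N x).

Section chains.
Context (R : realType).
Implicit Types (f g : nat -> R -> R) (m n i : nat) (x : R).

Lemma chain_le m n f : (m <= n)%N -> chain n f -> chain m f.
Proof. by move=> mn cf i im; apply: cf; exact: leq_trans im mn. Qed.

Lemma chain_derive1n n f m x : chain n f -> (m <= n)%N -> 0 < x ->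
  derive1n m (f 0%N) x = f m x.
Proof.
move=> cf; elim: m x => [//|m IH] x mn x0.
rewrite derive1nS derive1E.
have D : is_derive x 1 (derive1n m (f 0%N)) (f m.+1 x).
  apply: (@eq_is_derive_pos _ (f m)) => //; last exact: cf.
  by move=> y y0; rewrite IH// ltnW.
exact: derive_val.
Qed.

(** Lets an identity valid on (0,oo) be differentiated m times. *)
Lemma chain_unique n f g m x : chain n f -> chain n g ->
  (forall y, 0 < y -> f 0%N y = g 0%N y) -> (m <= n)%N -> 0 < x ->
  f m x = g m x.
Proof.
move=> cf cg fg; elim: m x => [|m IH] x mn x0; first exact: fg.
have D := @eq_is_derive_pos _ _ (g m) _ _ (fun y y0 => IH y (ltnW mn) y0) x0
  (cf m mn x x0).
have Dg := cg m mn x x0.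
by rewrite -(derive_val (is_derive := D)) -(derive_val (is_derive := Dg)).
Qed.

Let leibnizS f g m x :
  \sum_(0 <= i < m.+1) 'C(m, i)%:R *
    (f i.+1 x * g (m - i)%N x + f i x * g (m - i).+1 x) = leibniz f g m.+1 x.
Proof.
rewrite /leibniz; under eq_bigr do rewrite mulrDr.
rewrite big_split/= [RHS]big_nat_recl//=.
under [in RHS]eq_bigr => i _ do rewrite subSS binS natrD mulrDl.
rewrite [X in _ = _ + X]big_split/= [RHS]addrA [RHS]addrC; congr (_ + _).
rewrite big_nat_recl//= [X in _ = _ + X]big_nat_recr//= !bin0 !subn0.
rewrite bin_small// mul0r addr0; congr (_ + _).
by apply: eq_big_nat => i /andP[_ im]; rewrite subnSK.
Qed.

Lemma chain_leibniz n f g : chain n f -> chain n g -> chain n (leibniz f g).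
Proof.
move=> cf cg m mn x x0; rewrite -leibnizS.
(* [is_derive_sum_nat] asks for a derivative at every index; the factor [*+ (i <= m)] makes the
   terms beyond m, where the chains may have ended, equal to 0. *)
pose h i y : R := 'C(m, i)%:R * (f i y * g (m - i)%N y) *+ (i <= m).
have hE : leibniz f g m = (fun y => \sum_(0 <= i < m.+1) h i y).
  apply/funext => y; apply: eq_big_nat => i /andP[_ im].
  by rewrite /h -ltnS im.
rewrite hE [X in is_derive _ _ _ X](_ : _ = \sum_(0 <= i < m.+1)
    ('C(m, i)%:R * (f i.+1 x * g (m - i)%N x + f i x * g (m - i).+1 x)
     *+ (i <= m))); last first.
  by apply: eq_big_nat => i /andP[_ im]; rewrite -ltnS im.
apply: is_derive_sum_nat => i; rewrite /h; case: leqP => im; last first.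
  by rewrite !mulr0n; exact: is_derive_cst_fun.
rewrite !mulr1n; apply: is_deriveZ_fun; apply: is_deriveM_fun.
  by apply: cf => //; exact: leq_ltn_trans im mn.
by apply: cg => //; exact: leq_ltn_trans (leq_subr _ _) mn.
Qed.

Lemma leibniz0 f g x : leibniz f g 0%N x = f 0%N x * g 0%N x.
Proof. by rewrite /leibniz big_nat1 bin0 mul1r. Qed.

Lemma leibniz_le f g m x (D : R) :
  (forall i k, (i + k)%N = m -> `|f i x| * `|g k x| <= D) ->
  `|leibniz f g m x| <= 2 ^+ m * D.
Proof.
move=> fgD; apply: le_trans (ler_norm_sum _ _ _) _.
have -> : 2 ^+ m = \sum_(0 <= i < m.+1) 'C(m, i)%:R :> R.
  rewrite -natr_sum -natrX; congr (_%:R).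
  by rewrite big_mkord -[2%N]/(1 + 1)%N expnDn; apply: eq_bigr => i _;
    rewrite !exp1n !muln1.
rewrite mulr_suml !big_nat; apply: ler_sum => i /andP[_ im].
rewrite normrM normr_nat ler_wpM2l// normrM; apply: fgD.
by rewrite subnKC.
Qed.

(** The falling factorial vanishes when b is a natural number below i; this is what admits the
    exceptional values of alpha. *)
Definition powR_chain (b : R) (i : nat) (x : R) : R :=
  (\prod_(0 <= k < i) (b - k%:R)) * x `^ (b - i%:R).

Lemma chain_powR b n : chain n (powR_chain b).
Proof.
move=> i _ x x0; rewrite /powR_chain big_nat_recr//= -mulrA.
apply: is_deriveZ_fun.
have -> : b - i.+1%:R = b - i%:R - 1 by rewrite -natr1 opprD addrA.
exact: is_derive_powR.
Qed.

End chains.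

(** * Modified Bessel functions *)

Section bessel_series_calculus.
Context (R : realType).
Implicit Types (b s x : R) (n : nat).

Let b1_gt0 b : -1 < b -> 0 < b + 1.
Proof. by rewrite -ltrBlDr sub0r. Qed.

Lemma bessel_coeff_diffs b :
  pseries_diffs (bessel_coeff b) = (fun n => (b + 1)^-1 * bessel_coeff (b + 1) n).
Proof.
apply/funext => n; rewrite /pseries_diffs /bessel_coeff factS pochhammerSl natrM.
have n0 : n.+1%:R != 0 :> R by rewrite pnatr_eq0.
by rewrite !invfM !mulrA mulfV// mul1r [n`!%:R^-1 * _]mulrC.
Qed.

Let is_cvg_scaled b k s : -1 < b ->
  cvgn (pseries (fun n => k * bessel_coeff b n) s).
Proof.
move=> b1; have -> : pseries (fun n => k * bessel_coeff b n) s =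
    (fun N => k * pseries (bessel_coeff b) s N).
  by apply/funext => N; rewrite /pseries /series/= mulr_sumr;
    under eq_bigr do rewrite -mulrA.
by apply: is_cvgMr; exact: is_cvg_bessel_series.
Qed.

Let lim_scaled b k s : -1 < b ->
  limn (pseries (fun n => k * bessel_coeff b n) s) = k * bessel_series b s.
Proof.
move=> b1; have -> : pseries (fun n => k * bessel_coeff b n) s =
    (fun N => k * pseries (bessel_coeff b) s N).
  by apply/funext => N; rewrite /pseries /series/= mulr_sumr;
    under eq_bigr do rewrite -mulrA.
by apply: (cvg_lim _ (cvgMr _)) => //; exact: is_cvg_bessel_series.
Qed.

Lemma is_derive_bessel_series b s : -1 < b ->
  is_derive s 1 (bessel_series b) ((b + 1)^-1 * bessel_series (b + 1) s).
Proof.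
move=> b1; have b2 : -1 < b + 1 by rewrite (lt_trans b1)// ltrDl.
have b3 : -1 < b + 1 + 1 by rewrite (lt_trans b2)// ltrDl.
rewrite -lim_scaled// -bessel_coeff_diffs.
apply: (@pseries_snd_diffs _ _ (`|s| + 1)).
- exact: is_cvg_bessel_series.
- by rewrite bessel_coeff_diffs; exact: is_cvg_scaled.
- have -> : pseries_diffs (pseries_diffs (bessel_coeff b)) =
      (fun n => (b + 1)^-1 * (b + 1 + 1)^-1 * bessel_coeff (b + 1 + 1) n).
    rewrite bessel_coeff_diffs; apply/funext => n.
    rewrite /pseries_diffs mulrCA -[_ * bessel_coeff _ _]/(pseries_diffs _ n).
    by rewrite bessel_coeff_diffs mulrA.
  exact: is_cvg_scaled.
- by rewrite [ltRHS]ger0_norm ?addr_ge0// ltrDl.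
Qed.

(** In terms of Bessel functions: I_b - I_(b+2) = (2(b+1)/x) I_(b+1). It turns the first-order
    derivative formula into the modified Bessel equation. *)
Lemma bessel_series_contiguous b s : -1 < b ->
  bessel_series b s = bessel_series (b + 1) s
    + s / ((b + 1) * (b + 2)) * bessel_series (b + 2) s.
Proof.
move=> b1; have b10 := b1_gt0 b1.
have b2 : -1 < b + 1 by rewrite (lt_trans b1)// ltrDl.
have b3 : -1 < b + 2 by rewrite (lt_trans b1)// ltrDl.
rewrite {1}/bessel_series; apply: cvg_lim => //.
rewrite -(cvg_shiftS (pseries (bessel_coeff b) s)) /=.
have part N : pseries (bessel_coeff b) s N.+1 = pseries (bessel_coeff (b + 1)) s N.+1
    + s / ((b + 1) * (b + 2)) * pseries (bessel_coeff (b + 2)) s N.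
  rewrite /pseries /series/= mulr_sumr !big_nat_recl//= -addrA -big_split/=.
  congr (_ + _); first by rewrite /bessel_coeff /pochhammer !big_nil.
  apply: eq_bigr => n _; rewrite /bessel_coeff exprS.
  have E : (b + 2) * pochhammer (b + 2 + 1) n =
      pochhammer (b + 2) n * (b + 2 + n%:R).
    by rewrite -pochhammerSl pochhammerS.
  rewrite (pochhammerSl (b + 1)) pochhammerS factS natrM.
  have -> : b + 1 + 1 = b + 2 by rewrite -addrA.
  have P0 : 0 < pochhammer (b + 2) n by rewrite pochhammer_gt0// -ltrBlDr; lra.
  have n0 : 0 <= n%:R :> R by [].
  have b20 : 0 < b + 2 by lra.
  have -> : pochhammer (b + 2 + 1) n =
      pochhammer (b + 2) n * (b + 2 + n%:R) / (b + 2).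
    by rewrite -E mulrC mulKf// gt_eqF.
  have f0 : n`!%:R != 0 :> R by rewrite pnatr_eq0 -lt0n fact_gt0.
  rewrite -[n.+1%:R]natr1; move: P0 n0; move: (pochhammer _ _) n%:R => P N' P0 N0.
  by field; rewrite f0 /=; do ?[apply/andP; split]; apply: lt0r_neq0; lra.
under eq_cvg do rewrite part.
apply: cvgD.
  rewrite (cvg_shiftS (pseries (bessel_coeff (b + 1)) s)).
  exact: is_cvg_bessel_series.
by apply: cvgMr; exact: is_cvg_bessel_series.
Qed.

Lemma bessel_series_ge0 b s : -1 < b -> 0 <= s -> 0 <= bessel_series b s.
Proof.
move=> b1 s0; apply: limr_ge; first exact: is_cvg_bessel_series.
near=> N; apply: sumr_ge0 => n _.
by rewrite mulr_ge0 ?bessel_coeff_ge0 ?exprn_ge0.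
Unshelve. all: by end_near. Qed.

Lemma bessel_series_le b s : -1 < b -> 0 <= s ->
  bessel_series b s <= expR (s / (b + 1)).
Proof.
move=> b1 s0; have b10 := b1_gt0 b1.
apply: ler_lim; [exact: is_cvg_bessel_series|exact: is_cvg_series_exp_coeff|].
near=> N; apply: ler_sum => n _; rewrite /exp_coeff/=.
apply: (@le_trans _ _ ((n`!%:R * (b + 1) ^+ n)^-1 * s ^+ n)).
  by rewrite ler_wpM2r ?exprn_ge0// bessel_coeff_le.
by rewrite invfM exprMn exprVn mulrC mulrA mulrAC.
Unshelve. all: by end_near. Qed.

(* [x ^ (- b) * I_b x], up to a constant factor *)
Definition bessel_entire b x : R := bessel_series b (x ^+ 2 / 4).

Lemma is_derive_bessel_entire b x : -1 < b ->
  is_derive x 1 (bessel_entire b) (x / (2 * (b + 1)) * bessel_entire (b + 1) x).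
Proof.
move=> b1; have b10 := b1_gt0 b1.
have H : is_derive x 1 (fun y : R => y ^+ 2 / 4) (x / 2).
  have -> : (fun y : R => y ^+ 2 / 4) = (fun y => 4^-1 * y ^+ 2).
    by apply/funext => y; rewrite mulrC.
  apply: (is_derive_eq (is_deriveZ_fun _ (is_deriveX_fun 2 x))).
  by rewrite expr1; field.
have D := @is_derive1_comp R (bessel_series b) (fun y => y ^+ 2 / 4) x _ _
  (is_derive_bessel_series (x ^+ 2 / 4) b1) H.
apply: (is_derive_eq D); rewrite /bessel_entire; field.
by rewrite gt_eqF.
Qed.

Lemma bessel_entire_ge0 b x : -1 < b -> 0 <= bessel_entire b x.
Proof. by move=> b1; rewrite bessel_series_ge0// divr_ge0// sqr_ge0. Qed.

(* The modified Bessel equation, for [y = bessel_entire b] and its derivative. *)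
Lemma is_derive2_bessel_entire b x : -1 < b -> 0 < x ->
  is_derive x 1 (fun y => y / (2 * (b + 1)) * bessel_entire (b + 1) y)
    (bessel_entire b x
     - (2 * b + 1) / x * (x / (2 * (b + 1)) * bessel_entire (b + 1) x)).
Proof.
move=> b1 x0; have b10 := b1_gt0 b1.
have b2 : -1 < b + 1 by rewrite (lt_trans b1)// ltrDl.
have H : is_derive x 1 (fun y : R => y / (2 * (b + 1))) (2 * (b + 1))^-1.
  have -> : (fun y : R => y / (2 * (b + 1))) = (fun y => (2 * (b + 1))^-1 * y + 0).
    by apply/funext => y; rewrite mulrC addr0.
  exact: is_derive_affine.
apply: (is_derive_eq (is_deriveM_fun H (is_derive_bessel_entire x b2))).
rewrite [in RHS]/bessel_entire (bessel_series_contiguous _ b1) -!/(bessel_entire _ _).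
have -> : b + 1 + 1 = b + 2 by rewrite -addrA.
rewrite -/(bessel_entire (b + 2) x).
by field; rewrite !gt_eqF//; lra.
Qed.

End bessel_series_calculus.

(** * Derivatives of the profile *)

Section exponential_decay.
Context (R : realType).
Implicit Types (y r : R -> R) (p : nat) (K x : R).

(* [z = y exp(2x)] satisfies [|z'| <= B'] for [B = A (x + p)^(-p) exp(2x)], because
   the logarithmic derivative of [B] is [2 - p / (x + p) >= 1]. *)
Lemma linear_ode_decay y r p K :
  (forall x, 1 <= x -> is_derive x 1 y (r x - 2 * y x)) ->
  0 <= K -> (forall x, 1 <= x -> `|r x| <= K * x ^- p) ->
  exists2 K', 0 <= K' & forall x, 1 <= x -> `|y x| <= K' * x ^- p.
Proof.
(* The factor (1+p)^p pays for x + p <= (1+p) x; K is there for the derivative of z and |y 1| for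
   its initial value. *)
move=> dy K0 rK; pose A := (K + `|y 1|) * (1 + p%:R) ^+ p.
have A0 : 0 <= A by rewrite mulr_ge0 ?exprn_ge0 ?addr_ge0.
exists A => // x x1.
(* The shift by p keeps the logarithmic derivative at least 1 on all of [1,oo); with x^(-p) it would
   be 2 - p/x, negative near 1 for large p. *)
pose B x := A * ((x + p%:R) `^ (- p%:R) * expR (2 * x)).
pose Wm x := (x + p%:R) `^ (- p%:R - 1).
have xp (z : R) : 1 <= z -> 0 < z + p%:R by move=> z1; rewrite ltr_pwDl// (lt_le_trans _ z1).
have He (z : R) : is_derive z 1 (fun z : R => expR (2 * z)) (2 * expR (2 * z)).
  have D := is_derive_expR_comp (is_deriveZ_fun 2 (is_derive_id_fun z)).
  by apply: (is_derive_eq D); rewrite mulr1.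
have dB (z : R) : 1 <= z -> is_derive z 1 B (A * (Wm z * expR (2 * z) * (2 * z + p%:R))).
  move=> z1.
  have H : is_derive z 1 (fun z : R => z + p%:R) 1.
    have D := is_deriveD_fun (is_derive_id_fun z) (is_derive_cst_fun p%:R z).
    by apply: (is_derive_eq D); rewrite addr0.
  have D := @is_derive1_comp R (fun u => u `^ (- p%:R)) (fun u => u + p%:R) z _ _
    (is_derive_powR _ (xp z z1)) H.
  apply: (is_derive_eq (is_deriveZ_fun A (is_deriveM_fun D (He z)))).
  by rewrite /= (powR_pred (- p%:R) (xp z z1)) -/(Wm z); congr (_ * _); ring.
have dz (z : R) : 1 <= z -> is_derive z 1 (fun z => y z * expR (2 * z)) (r z * expR (2 * z)).
  by move=> z1; apply: (is_derive_eq (is_deriveM_fun (dy z z1) (He z))); ring.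
have cmp (z : R) : 1 <= z -> K * z ^- p * expR (2 * z) <=
    A * (Wm z * expR (2 * z) * (2 * z + p%:R)).
  move=> z1; have z0 : 0 < z by rewrite (lt_le_trans _ z1).
  have e0 := expR_gt0 (2 * z).
  have -> : A * (Wm z * expR (2 * z) * (2 * z + p%:R)) =
      A * (Wm z * (2 * z + p%:R)) * expR (2 * z) by ring.
  rewrite ler_pM2r//.
  apply: (@le_trans _ _ (A * (z + p%:R) ^- p)); last first.
    rewrite ler_wpM2l// -powR_invn ?(ltW (xp z z1))//.
    rewrite (powR_pred _ (xp z z1)) -/(Wm z) mulrC.
    by apply: ler_wpM2l; [exact: powR_ge0|lra].
  rewrite ler_pdivlMr ?exprn_gt0 ?xp// /A -mulrA.
  apply: (@le_trans _ _ (K * (1 + p%:R) ^+ p)); last first.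
    by rewrite ler_wpM2r ?exprn_ge0 ?addr_ge0// lerDl.
  rewrite ler_wpM2l// mulrC ler_pdivrMr ?exprn_gt0// -exprMn.
  rewrite lerXn2r ?nnegrE ?mulr_ge0 ?addr_ge0 ?(ltW z0)//.
  by rewrite mulrDl mul1r lerD2l ler_peMr.
have init : `|y 1| * expR (2 * 1) <= B 1.
  rewrite /B mulrA ler_pM2r ?expR_gt0// powR_invn ?addr_ge0// /A.
  by rewrite mulfK ?lerDr// expf_neq0// gt_eqF// ltr_pwDl.
(* The signs e = 1 and e = -1 together bound |z|. *)
have bound (e : R) : `|e| = 1 -> e * (y x * expR (2 * x)) <= B x.
  move=> e1; pose dB' z := A * (Wm z * expR (2 * z) * (2 * z + p%:R)).
  have D z : 1 <= z -> z <= x ->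
      is_derive z 1 (fun z : R => e * (y z * expR (2 * z)) + -1 * B z)
        (e * (r z * expR (2 * z)) + -1 * dB' z).
    by move=> z1 _; apply: is_deriveD_fun; apply: is_deriveZ_fun; [exact: dz|exact: dB].
  have H := derive_le0_le x1 D.
  rewrite -subr_le0 -mulN1r; apply: le_trans (H _) _ => [z z1 _|].
    rewrite mulN1r subr_le0; apply: le_trans (cmp z z1).
    rewrite mulrA ler_wpM2r ?expR_ge0// (le_trans (ler_norm _))//.
    by rewrite normrM e1 mul1r rK.
  rewrite mulN1r subr_le0; apply: le_trans init.
  rewrite mulrA ler_wpM2r ?expR_ge0// (le_trans (ler_norm _))//.
  by rewrite normrM e1 mul1r.
have e0 := expR_gt0 (2 * x).
rewrite -(ler_pM2r e0) -[expR _ in leLHS]gtr0_norm// -normrM ler_norml.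
have BA : B x <= A * x ^- p * expR (2 * x).
  rewrite /B mulrA ler_pM2r// ler_wpM2l// powR_invn ?(ltW (xp x x1))//.
  have x0 : 0 < x by rewrite (lt_le_trans _ x1).
  rewrite lef_pV2 ?posrE ?exprn_gt0 ?xp// lerXn2r ?nnegrE ?lerDl//.
    exact: ltW.
  exact/ltW/xp.
have := bound 1 (normr1 R); rewrite mul1r => /le_trans/(_ BA) ->.
by have := bound (-1) (normrN1 R); rewrite mulN1r lerNl => /(le_trans _) ->;
  rewrite // lerN2.
Qed.

End exponential_decay.

(** * Bounds for the derivatives of the profile on (0,1] and on [1,oo) *)

Section profile.
Context (R : realType).
Implicit Types (b x : R) (n m i : nat).

(** Describes the factors of the profile other than x^a, whose derivatives stay bounded near 0;
    stable under Leibniz products. *)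
Definition bounded_chain n (f : nat -> R -> R) : Prop :=
  chain n f /\ exists2 C, 0 <= C & forall i x, (i <= n)%N -> 0 < x -> x <= 1 ->
    `|f i x| <= C.

Lemma bounded_chain_leibniz n f g : bounded_chain n f -> bounded_chain n g ->
  bounded_chain n (leibniz f g).
Proof.
move=> [cf [C C0 hC]] [cg [D D0 hD]]; split; first exact: chain_leibniz.
exists (2 ^+ n * (C * D)); first by rewrite !mulr_ge0 ?exprn_ge0.
move=> m x mn x0 x1; apply: (@le_trans _ _ (2 ^+ m * (C * D))); last first.
  by rewrite ler_wpM2r ?mulr_ge0// ler_weXn2l// ler1n.
apply: leibniz_le => i k ik; apply: ler_pM => //; [apply: hC|apply: hD] => //;
  apply: leq_trans mn; by rewrite -ik ?leq_addr ?leq_addl.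
Qed.

Let cons_chain (f : R -> R) (g : nat -> R -> R) i : R -> R :=
  if i is k.+1 then g k else f.

Lemma bounded_chain_cons n f g (C : R) : bounded_chain n g -> 0 <= C ->
  (forall x, 0 < x -> is_derive x 1 f (g 0%N x)) ->
  (forall x, 0 < x -> x <= 1 -> `|f x| <= C) ->
  bounded_chain n.+1 (cons_chain f g).
Proof.
move=> [cg [D D0 hD]] C0 df fC; split.
  by case=> [|i] im x x0 /=; [exact: df|exact: cg].
exists (C + D); first exact: addr_ge0.
move=> [|i] x im x0 x1 /=.
  by apply: le_trans (fC x x0 x1) _; rewrite lerDl.
by apply: le_trans (hD i x im x0 x1) _; rewrite lerDr.
Qed.

Let is_derive_half (k x : R) : is_derive x 1 (fun y : R => k * y) k.
Proof.
by apply: (is_derive_eq (is_deriveZ_fun k (is_derive_id_fun x))); rewrite mulr1.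
Qed.

Lemma bounded_chain_linear n (k : R) :
  exists2 h, bounded_chain n h & h 0%N = (fun y => k * y).
Proof.
pose h i y : R := if i is i'.+1 then (if i' is 0%N then k else 0) else k * y.
exists h => //; split.
  case=> [|[|i]] _ x x0 /=; [exact: is_derive_half|exact: is_derive_cst_fun|
    exact: is_derive_cst_fun].
exists `|k| => // i x _ x0 x1; case: i => [|[|i]] /=.
- by rewrite normrM ler_piMr// ger0_norm// ltW.
- by [].
- by rewrite normr0.
Qed.

(** The derivative is a multiple of x times the same function of order b + 1, so a chain of length n
    for order b + 1 gives, by a Leibniz product, one of length n + 1 for order b. Hence the
    induction over all b at once. *)
Lemma bounded_chain_bessel_entire n b : -1 < b ->
  exists2 g, bounded_chain n g & g 0%N = bessel_entire b.
Proof.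
have bound c : -1 < c -> exists2 C, 0 <= C & forall x, 0 < x -> x <= 1 ->
    `|bessel_entire c x| <= C.
  move=> c1; have c10 : 0 < c + 1 by rewrite -ltrBlDr sub0r.
  exists (expR ((c + 1)^-1)); first exact: expR_ge0.
  move=> x x0 x1; rewrite ger0_norm ?bessel_entire_ge0//.
  have s0 : 0 <= x ^+ 2 / 4 by rewrite divr_ge0// sqr_ge0.
  apply: le_trans (bessel_series_le c1 s0) _; rewrite ler_expR.
  rewrite -[leRHS]mul1r ler_wpM2r ?invr_ge0 ?(ltW c10)//.
  have : x ^+ 2 <= 1 by rewrite expr_le1// ltW.
  lra.
elim: n b => [|n IH] b b1; have [C C0 hC] := bound b b1.
  exists (fun _ => bessel_entire b) => //; split=> //.
  by exists C => // i x _; exact: hC.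
have b2 : -1 < b + 1 by rewrite (lt_trans b1)// ltrDl.
have [g bg g0] := IH _ b2.
have [h bh h0] := bounded_chain_linear n (2 * (b + 1))^-1.
exists (cons_chain (bessel_entire b) (leibniz h g)) => //.
apply: (bounded_chain_cons (C := C)) => //; first exact: bounded_chain_leibniz.
move=> x x0; rewrite leibniz0 h0 g0.
by have := is_derive_bessel_entire x b1; rewrite [x / _]mulrC.
Qed.

Lemma bounded_chain_expRN n :
  exists2 h, bounded_chain n h & h 0%N = (fun y => expR (- y)).
Proof.
exists (fun i y => (-1) ^+ i * expR (- y)); last first.
  by apply/funext => y; rewrite expr0 mul1r.
split=> [i _ x x0|].
  have H : is_derive x 1 (fun y : R => - y) (-1).
    have -> : (fun y : R => - y) = (fun y => -1 * y).
      by apply/funext => y; rewrite mulN1r.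
    exact: is_derive_half.
  rewrite exprSr -mulrA; apply: is_deriveZ_fun; exact: is_derive_expR_comp.
exists 1 => // i x _ x0 x1.
rewrite normrM normrX normrN1 expr1n mul1r ger0_norm ?expR_ge0//.
by rewrite expR_le1 oppr_le0 ltW.
Qed.

Section bessel_profile_bounds.
Context (alpha : R).
Context (alpha_ge : 0 <= alpha + 1 / 2).
Let a := alpha + 1 / 2.

Let alpha1 : -1 < alpha.
Proof. by move: alpha_ge => ?; lra. Qed.

Let weight x : R := x `^ a * expR (- x).

Let G := bessel_entire alpha.

Let H x : R := x / (2 * (alpha + 1)) * bessel_entire (alpha + 1) x.

Let F := bessel_profile alpha.

Let F1 x : R := weight x * ((a / x - 1) * G x + H x).

Let FE x : F x = weight x * G x.
Proof. by rewrite /F /bessel_profile /weight mulrA. Qed.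

Let is_derive_weight x : 0 < x -> is_derive x 1 weight (weight x * (a / x - 1)).
Proof.
move=> x0.
have D : is_derive x 1 (fun y : R => - y) (-1).
  have -> : (fun y : R => - y) = (fun y => -1 * y).
    by apply/funext => y; rewrite mulN1r.
  exact: is_derive_half.
apply: (is_derive_eq (is_deriveM_fun (is_derive_powR a x0) (is_derive_expR_comp D))).
rewrite /weight (powR_pred a x0).
by field; rewrite gt_eqF.
Qed.

Let is_derive_F x : 0 < x -> is_derive x 1 F (F1 x).
Proof.
move=> x0; have -> : F = (fun x => weight x * G x) by apply/funext => y; exact: FE.
have D := is_deriveM_fun (is_derive_weight x0) (is_derive_bessel_entire x alpha1).
apply: (is_derive_eq D); rewrite /F1 /H /G; ring.
Qed.

Let is_derive_F1 x : 0 < x ->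
  is_derive x 1 F1 (a * (a - 1) / x ^+ 2 * F x - 2 * F1 x).
Proof.
move=> x0; have xn0 : x != 0 by rewrite gt_eqF.
have Dinv : is_derive x 1 (fun y : R => a * y^-1 + -1) (a * - x ^- 2).
  have D := is_deriveD_fun (is_deriveZ_fun a
    (is_deriveV xn0 (is_derive_id_fun x))) (is_derive_cst_fun (-1) x).
  by apply: (is_derive_eq D); rewrite addr0 /GRing.scale/= mulr1.
have D := is_deriveM_fun (is_derive_weight x0)
  (is_deriveD_fun (is_deriveM_fun Dinv (is_derive_bessel_entire x alpha1))
     (is_derive2_bessel_entire alpha1 x0)).
apply: (is_derive_eq D); rewrite FE /F1 -/(H x) -/G /a.
have -> : 2 * alpha + 1 = 2 * (alpha + 1 / 2) by field.
move: (H x) (G x) (weight x) => h g w; field.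
exact: xn0.
Qed.

Let F_ge0 x : 0 <= F x.
Proof. by rewrite FE !mulr_ge0 ?powR_ge0 ?expR_ge0 ?bessel_entire_ge0. Qed.

(** F + F' = exp(-x) (exp(x) F)', and exp(x) F = x^a G has nonnegative derivative because a >= 0. *)
Let FF1_ge0 x : 0 < x -> 0 <= F x + F1 x.
Proof.
move=> x0; have alpha2 : -1 < alpha + 1 by rewrite (lt_trans alpha1)// ltrDl.
have -> : F x + F1 x = weight x * (a / x * G x + H x) by rewrite FE /F1; ring.
rewrite !mulr_ge0 ?powR_ge0 ?expR_ge0// addr_ge0// mulr_ge0 ?bessel_entire_ge0//.
  by rewrite divr_ge0// ltW.
by rewrite divr_ge0 ?(ltW x0)// mulr_ge0// -lerBlDr sub0r ltW.
Qed.

(* [E = 2 F + F'] satisfies [F <= E] and [E' <= |a (a - 1)| E / x ^ 2]. *)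
Let F_bounded : exists2 C, 0 <= C & forall x, 1 <= x -> F x <= C.
Proof.
pose nu := `|a * (a - 1)|; pose E x := 2 * F x + F1 x.
have E_ge x : 0 < x -> F x <= E x.
  by move=> x0; have := FF1_ge0 x0; rewrite /E; lra.
exists (E 1 * expR nu).
  by rewrite mulr_ge0 ?expR_ge0// (le_trans (F_ge0 1))// E_ge.
move=> x x1.
have pos (z : R) : 1 <= z -> 0 < z by exact: lt_le_trans.
(* The integrating factor exp(nu/z) makes E(z) exp(nu/z) nonincreasing, and it lies between 1 and
   exp(nu) on [1,oo). *)
have D (z : R) : 1 <= z -> z <= x -> is_derive z 1 (fun z => E z * expR (nu * z^-1))
    ((2 * F1 z + (a * (a - 1) / z ^+ 2 * F z - 2 * F1 z)) * expR (nu * z^-1)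
     + E z * (nu * - z ^- 2 * expR (nu * z^-1))).
  move=> z1 _; have z0 := pos z z1; have zn0 : z != 0 by rewrite gt_eqF.
  have Dinv : is_derive z 1 (fun y : R => nu * y^-1) (nu * - z ^- 2).
    have D := is_deriveZ_fun nu (is_deriveV zn0 (is_derive_id_fun z)).
    by apply: (is_derive_eq D); rewrite /GRing.scale/= mulr1.
  apply: is_deriveM_fun; last exact: is_derive_expR_comp.
  by apply: is_deriveD_fun; [apply: is_deriveZ_fun; exact: is_derive_F|exact: is_derive_F1].
have L := derive_le0_le x1 D.
apply: le_trans (E_ge x (pos x x1)) _.
apply: (@le_trans _ _ (E x * expR (nu * x^-1))).
  rewrite ler_peMr ?(le_trans (F_ge0 x) (E_ge x (pos x x1)))//.
  by rewrite -expR0 ler_expR divr_ge0 ?normr_ge0// ltW// pos.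
have := L; rewrite invr1 mulr1; apply => z z1 _; have z0 := pos z z1.
rewrite [X in X <= _](_ : _ =
  (a * (a - 1) * F z - nu * E z) * (z ^- 2 * expR (nu * z^-1))); last first.
  by rewrite /nu; ring.
rewrite mulr_le0_ge0 ?mulr_ge0 ?invr_ge0 ?expR_ge0 ?sqr_ge0// subr_le0.
apply: (@le_trans _ _ (nu * F z)); first by rewrite ler_wpM2r// ler_norm.
by rewrite ler_wpM2l ?normr_ge0// E_ge.
Qed.

Let nat_bound m (h : nat -> R) :
  exists2 C, 0 <= C & forall i, (i <= m)%N -> `|h i| <= C.
Proof.
elim: m => [|m [C C0 hC]]; first by exists `|h 0%N| => // i; rewrite leqn0 => /eqP ->.
exists (C + `|h m.+1|); first exact: addr_ge0.
move=> i; rewrite leq_eqVlt => /predU1P[->|im]; first by rewrite lerDr.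
by apply: le_trans (hC i im) _; rewrite lerDl.
Qed.

(** The equation F'' + 2F' = a(a-1) F/x^2 differentiated m times; its right side involves only f 0,
    ..., f m. *)
Let ode_chain n f m x : chain n f -> f 0%N = F -> (m.+2 <= n)%N -> 0 < x ->
  f m.+2 x + 2 * f m.+1 x =
  leibniz f (fun i y => a * (a - 1) * powR_chain (-2) i y) m x.
Proof.
move=> cf f0 mn x0.
have n0 : (0 < n)%N by exact: leq_trans mn.
have n1 : (1 < n)%N by exact: leq_trans mn.
have f1 y : 0 < y -> f 1%N y = F1 y.
  move=> y0; have D := cf 0%N n0 y y0; rewrite f0 in D.
  rewrite -(derive_val (is_derive := D)).
  exact: (derive_val (is_derive := is_derive_F y0)).
have f2 y : 0 < y -> f 2%N y = a * (a - 1) / y ^+ 2 * F y - 2 * F1 y.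
  move=> y0; have D := eq_is_derive_pos f1 y0 (cf 1%N n1 y y0).
  rewrite -(derive_val (is_derive := D)).
  exact: (derive_val (is_derive := is_derive_F1 y0)).
apply: (@chain_unique R m (fun i y => f i.+2 y + 2 * f i.+1 y)) => //.
- move=> i im y y0; apply: is_deriveD_fun; last apply: is_deriveZ_fun.
    by apply: cf => //; apply: leq_trans mn; rewrite !ltnS.
  by apply: cf => //; apply: leq_trans mn; rewrite !ltnS ltnW.
- apply: chain_leibniz; first exact: chain_le (leq_trans (leqnSn _) (ltnW mn)) cf.
  by move=> i im y y0; apply: is_deriveZ_fun; exact: (@chain_powR R _ m).
- move=> y y0; rewrite leibniz0 f2// f1// f0 /powR_chain big_nil mul1r subr0.
  by rewrite powR_invn ?(ltW y0)//; ring.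
Qed.

(** The next derivative solves y' = r - 2y, where r depends only on f 0, ..., f m and is O(x^(-m-2))
    by induction; [linear_ode_decay] transfers the decay from r to y. *)
Let decay n f m : chain n f -> f 0%N = F -> (m.+2 <= n)%N -> exists2 C, 0 <= C &
  forall i x, (i <= m)%N -> 1 <= x -> `|f i x| <= C * x ^- i.
Proof.
move=> cf f0; elim: m => [|m IH] mn.
  have [C C0 hC] := F_bounded; exists C => // i x; rewrite leqn0 => /eqP -> x1.
  by rewrite f0 expr0 invr1 mulr1 ger0_norm ?F_ge0// hC.
have [C C0 hC] := IH (ltnW mn).
have [P P0 hP] := nat_bound m (fun i => a * (a - 1) * \prod_(0 <= k < i) (-2 - k%:R)).
have pos (z : R) : 1 <= z -> 0 < z by exact: lt_le_trans.
have [K' K'0 hK'] : exists2 K', 0 <= K' &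
    forall x, 1 <= x -> `|f m.+1 x| <= K' * x ^- m.+1.
  apply: (@linear_ode_decay R _ (fun x => f m.+2 x + 2 * f m.+1 x) _
    (2 ^+ m * (C * P))).
  - move=> x x1; rewrite addrK; apply: cf; [exact: ltnW|exact: pos].
  - by rewrite !mulr_ge0 ?exprn_ge0.
  - move=> x x1; rewrite (ode_chain cf) ?pos// ?(ltnW mn)// -mulrA.
    apply: leibniz_le => i k ik.
    have x0 := pos x x1.
    have ml : (i <= m)%N by rewrite -ik leq_addr.
    have mr : (k <= m)%N by rewrite -ik leq_addl.
    apply: (@le_trans _ _ (C * x ^- i * (P * x ^- k.+2))).
      apply: ler_pM => //; first exact: hC.
      rewrite /powR_chain mulrA normrM ler_pM// ?hP//.
      have -> : -2 - k%:R = - k.+2%:R :> R by rewrite -addn2 natrD; ring.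
      by rewrite powR_invn ?(ltW x0)// ger0_norm// invr_ge0 exprn_ge0// ltW.
    rewrite mulrACA ler_wpM2l ?mulr_ge0// -invfM -exprD.
    rewrite lef_pV2 ?posrE ?exprn_gt0// ler_weXn2l//.
    by rewrite -ik -addn2 addnA addn2 ltnS leqnSn.
exists (C + K'); first exact: addr_ge0.
move=> i x; rewrite leq_eqVlt => /predU1P[->|im] x1.
  apply: le_trans (hK' x x1) _; rewrite ler_wpM2r ?lerDr//.
  by rewrite invr_ge0 exprn_ge0// ltW// pos.
apply: le_trans (hC i x im x1) _; rewrite ler_wpM2r ?lerDl//.
by rewrite invr_ge0 exprn_ge0// ltW// pos.
Qed.

(** If a is a natural number below i, the coefficient is 0; otherwise a >= i, and on (0,1] a larger
    exponent gives a smaller power. This is where the condition on alpha is used. *)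
Let powR_chain_small j m i x :
  (exists2 N, (N <= j)%N & a = N%:R) \/ j%:R < a -> (m <= j)%N -> (i <= m)%N ->
  0 < x -> x <= 1 ->
  `|powR_chain a i x| <=
  `|\prod_(0 <= k < i) (a - k%:R)| * x `^ Num.max (a - m%:R) 0.
Proof.
move=> ha mj im x0 x1; rewrite /powR_chain normrM [`|x `^ _|]ger0_norm ?powR_ge0//.
have [->|nz] := eqVneq (\prod_(0 <= k < i) (a - k%:R)) 0.
  by rewrite normr0 !mul0r.
rewrite ler_wpM2l//; apply: ger_powR; first by rewrite x0.
have ai : 0 <= a - i%:R.
  case: ha => [[N Nj aN]|ja]; last first.
    by rewrite subr_ge0 ltW// (le_lt_trans _ ja)// ler_nat (leq_trans im).
  rewrite subr_ge0 aN ler_nat leqNgt; apply: contra nz => Ni.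
  by rewrite prodf_seq_eq0; apply/hasP; exists N; rewrite ?mem_index_iota//= aN subrr.
by rewrite ge_max ai andbT lerD2l lerN2 ler_nat.
Qed.

Lemma bessel_profile_chain n : exists f,
  [/\ chain n f, f 0%N = bessel_profile alpha,
    (forall m, (m.+2 <= n)%N -> exists2 C, 0 <= C &
      forall i x, (i <= m)%N -> 1 <= x -> `|f i x| <= C * x ^- i) &
    (forall j m, (exists2 i, (i <= j)%N & a = i%:R) \/ j%:R < a ->
      (m <= n)%N -> (m <= j)%N -> exists2 C, 0 <= C &
      forall x, 0 < x -> x <= 1 -> `|f m x| <= C * x `^ Num.max (a - m%:R) 0)].
Proof.
have [e be e0] := bounded_chain_expRN n.
have [g bg g0] := bounded_chain_bessel_entire n alpha1.
have [ck [D D0 hD]] := bounded_chain_leibniz be bg.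
pose f := leibniz (powR_chain a) (leibniz e g).
have cf : chain n f by apply: chain_leibniz => //; exact: chain_powR.
have f0 : f 0%N = bessel_profile alpha.
  apply/funext => x; rewrite /f !leibniz0 e0 g0 /powR_chain big_nil mul1r subr0.
  by [].
exists f; split => //.
  by move=> m mn; exact: decay cf f0 mn.
move=> j m ha mn mj.
have [P P0 hP] := nat_bound m (fun i => \prod_(0 <= k < i) (a - k%:R)).
exists (2 ^+ m * (P * D)); first by rewrite !mulr_ge0 ?exprn_ge0.
move=> x x0 x1; rewrite -mulrA; apply: leibniz_le => i k ik.
have ml : (i <= m)%N by rewrite -ik leq_addr.
have mr : (k <= m)%N by rewrite -ik leq_addl.
rewrite mulrAC; apply: ler_pM => //; last by apply: hD => //; exact: leq_trans mn.
apply: le_trans (powR_chain_small ha mj ml x0 x1) _.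
by rewrite ler_wpM2r ?powR_ge0// hP.
Qed.

End bessel_profile_bounds.
End profile.

(** * Gaussian estimates *)

Lemma uniform_bound (R : realType) (T : Type) (dom : T -> Prop)
    (h w : nat -> T -> R) (n : nat) :
  (forall i x, dom x -> 0 <= w i x) ->
  (forall i, (i <= n)%N -> exists2 C, 0 <= C & forall x, dom x ->
     `|h i x| <= C * w i x) ->
  exists2 C, 0 <= C & forall i x, (i <= n)%N -> dom x -> `|h i x| <= C * w i x.
Proof.
move=> w0; elim: n => [|n IH] hC.
  have [C C0 hC0] := hC 0%N isT; exists C => // i x; rewrite leqn0 => /eqP ->.
  exact: hC0.
have [C C0 hCn] := IH (fun i im => hC i (leqW im)).
have [D D0 hD] := hC n.+1 (leqnn _).
exists (C + D); first exact: addr_ge0.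
move=> i x; rewrite leq_eqVlt => /predU1P[->|im] dx.
  by apply: le_trans (hD x dx) _; rewrite ler_wpM2r ?w0// lerDr.
by apply: le_trans (hCn i x im dx) _; rewrite ler_wpM2r ?w0// lerDl.
Qed.

(** One term of the exponential series bounds the power by exp(eps r) with r = 1 + y + z, and r <= 3
    + y^2 + z^2 turns this into a Gaussian. *)
Lemma expn_le_gauss (R : realType) (eps : R) (N : nat) : 0 < eps ->
  exists2 C, 0 <= C & forall y z : R, 0 <= y -> 0 <= z ->
    (1 + y + z) ^+ N <= C * expR (eps * (y ^+ 2 + z ^+ 2)).
Proof.
move=> e0; case: N => [|N].
  exists 1 => // y z y0 z0; rewrite expr0 mul1r -[leLHS]expR0 ler_expR.
  by rewrite mulr_ge0 ?(ltW e0)// addr_ge0 ?sqr_ge0.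
exists (N.+1`!%:R * eps ^- N.+1 * expR (3 * eps)).
  by rewrite !mulr_ge0 ?expR_ge0 ?invr_ge0 ?exprn_ge0// ltW.
move=> y z y0 z0; set r := 1 + y + z.
have r0 : 0 <= r by rewrite /r; lra.
have f0 : 0 < N.+1`!%:R :> R by rewrite ltr0n fact_gt0.
have H : (eps * r) ^+ N.+1 <= N.+1`!%:R * expR (eps * r).
  rewrite [leRHS]mulrC -ler_pdivrMr//.
  by apply: le_trans (expR_ge1Dxn N (mulr_ge0 (ltW e0) r0)); rewrite lerDr.
have e1 : 0 < eps ^+ N.+1 by rewrite exprn_gt0.
have -> : N.+1`!%:R * eps ^- N.+1 * expR (3 * eps) * expR (eps * (y ^+ 2 + z ^+ 2)) =
    (eps ^+ N.+1)^-1 * (N.+1`!%:R * expR (3 * eps + eps * (y ^+ 2 + z ^+ 2))).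
  by rewrite expRD; ring.
rewrite ler_pdivlMl// -exprMn; apply: le_trans H _.
rewrite ler_wpM2l ?(ltW f0)// ler_expR [3 * eps]mulrC -mulrDr ler_wpM2l ?(ltW e0)//.
have := sqr_ge0 (y - 1); have := sqr_ge0 (z - 1); rewrite /r; nra.
Qed.

Section gaussian_chain.
Context (R : realType).
Implicit Types (m l u : R) (i : nat).

(* [d^i/du^i exp (P u) = gaussian_factor (P'' u) (P' u) i * exp (P u)] for a
   quadratic polynomial [P]; these are rescaled Hermite polynomials. *)
Fixpoint gaussian_factor m l i : R :=
  if i is i'.+1 then
    l * gaussian_factor m l i' +
    (if i' is i''.+1 then i'%:R * m * gaussian_factor m l i'' else 0)
  else 1.

Let gaussian_factorSS m l i : gaussian_factor m l i.+2 =
  l * gaussian_factor m l i.+1 + i.+1%:R * m * gaussian_factor m l i.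
Proof. by []. Qed.

(** Differentiation lowers the index by one, as for Hermite polynomials. *)
Let is_derive_gaussian_factor m b u i :
  is_derive u 1 (fun y => gaussian_factor m (m * y + b) i.+1)
    (i.+1%:R * m * gaussian_factor m (m * u + b) i).
Proof.
have D : is_derive u 1 (fun y : R => m * y + b) m by exact: is_derive_affine.
elim/ltn_ind: i => -[|i] IH.
  have H := is_deriveD_fun (is_deriveM_fun D (is_derive_cst_fun 1 u)) (is_derive_cst_fun 0 u).
  by apply: (is_derive_eq H) => /=; ring.
have H1 := IH i (ltnSn i).
have H2 : is_derive u 1 (fun y => gaussian_factor m (m * y + b) i)
   (if i is k.+1 then i%:R * m * gaussian_factor m (m * u + b) k else 0).
  case: i IH {H1} => [|k] IH; first exact: is_derive_cst_fun.
  by apply: IH; exact: leqnSn.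
have H := is_deriveD_fun (is_deriveM_fun D H1)
  (is_deriveZ_fun (i.+1%:R * m) H2).
apply: (is_derive_eq H); rewrite -/gaussian_factor.
have -> : gaussian_factor m (m * u + b) i.+1 = (m * u + b) * gaussian_factor m (m * u + b) i
   + (if i is k.+1 then i%:R * m * gaussian_factor m (m * u + b) k else 0) by [].
move: (if i is _.+1 then _ else _) (gaussian_factor m _ i) => z g.
by rewrite -[i.+2%:R]natr1; ring.
Qed.

Lemma chain_gaussian m b (E : R -> R) n :
  (forall u, is_derive u 1 E ((m * u + b) * E u)) ->
  chain n (fun i u => gaussian_factor m (m * u + b) i * E u).
Proof.
move=> dE [|i] _ u u0.
  have H := is_deriveM_fun (is_derive_cst_fun 1 u) (dE u).
  by apply: (is_derive_eq H) => /=; ring.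
have H := is_deriveM_fun (is_derive_gaussian_factor m b u i) (dE u).
apply: (is_derive_eq H); rewrite gaussian_factorSS.
by move: (gaussian_factor _ _ _) (gaussian_factor _ _ _) => g h; ring.
Qed.

Lemma gaussian_factor_ge0 (k : R) i : 0 <= k -> 0 <= gaussian_factor k k i.
Proof.
move=> k0; elim/ltn_ind: i => -[|[|i]] IH //=.
  by rewrite mulr1 addr0.
by rewrite -/(gaussian_factor k k i.+1) addr_ge0 ?mulr_ge0 ?IH.
Qed.

(** With weight 1 for l and 2 for m, the factor of index i is homogeneous of weight i with
    nonnegative coefficients, so it scales as the i-th power of [lam * om]. *)
Lemma gaussian_factor_le (k lam om m l : R) i : 0 <= k -> 0 <= lam -> 1 <= om ->
  `|l| <= k * (lam * om) -> `|m| <= k * lam ^+ 2 ->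
  `|gaussian_factor m l i| <= gaussian_factor k k i * (lam * om) ^+ i.
Proof.
move=> k0 lam0 om1 hl hm; have om0 : 0 <= om by exact: le_trans om1.
have lo0 : 0 <= lam * om by exact: mulr_ge0.
have hm2 : `|m| <= k * (lam * om) ^+ 2.
  apply: le_trans hm _; rewrite ler_wpM2l// exprMn ler_peMr ?sqr_ge0//.
  by rewrite expr_ge1.
elim/ltn_ind: i => -[|[|i]] IH.
- by rewrite /= expr0 mulr1 normr1.
- by rewrite /= !mulr1 !addr0 expr1.
rewrite !gaussian_factorSS (le_trans (ler_normD _ _))// mulrDl lerD//.
  rewrite normrM exprS mulrACA ler_pM//; exact: IH.
rewrite !normrM normr_nat -[in leRHS](addn2 i) exprD.
have -> : i.+1%:R * k * gaussian_factor k k i * ((lam * om) ^+ i * (lam * om) ^+ 2) =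
   i.+1%:R * (k * (lam * om) ^+ 2) * (gaussian_factor k k i * (lam * om) ^+ i) by ring.
by rewrite ler_pM ?mulr_ge0// ?ler_wpM2l// IH.
Qed.

End gaussian_chain.

(** * Elementary bounds for sinh 2t and tanh t *)

Section hyperbolic_bounds.
Context (R : realType).
Implicit Types t : R.

Lemma sinh2_ge t : 0 <= t -> t <= sinh2 t.
Proof.
move=> t0; rewrite /sinh2 ler_pdivlMr//.
have := expR_ge1Dx (2 * t).
have : expR (- (2 * t)) <= 1 by rewrite expR_le1; lra.
by move: (expR _) (expR _) => p q; lra.
Qed.

Lemma sinh2_le t : 0 <= t -> t <= 1 -> sinh2 t <= 2 * expR 2 * t.
Proof.
move=> t0 t1; rewrite sinh2E; set q := expR (- (2 * t)).
have q0 : 0 < q by exact: expR_gt0.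
have q2 : 1 - q ^+ 2 <= 4 * t.
  have -> : q ^+ 2 = expR (- (4 * t)) by rewrite -expRM_natr; congr expR; ring.
  by have := expR_ge1Dx (- (4 * t)); lra.
rewrite ler_pdivrMr ?mulr_gt0//.
have eq1 : 1 <= expR 2 * q by rewrite -expRD -[leLHS]expR0 ler_expR; lra.
apply: le_trans q2 _.
have -> : 2 * expR 2 * t * (2 * q) = 4 * t * (expR 2 * q) by ring.
by rewrite ler_peMr// mulr_ge0.
Qed.

Lemma sinh2_ge_expR t : 1 <= t -> expR (2 * t) / 4 <= sinh2 t.
Proof.
move=> t1; rewrite /sinh2.
have : expR (- (2 * t)) <= 1 by rewrite expR_le1; lra.
have := expR_ge1Dx (2 * t).
by move: (expR _) (expR _) => p q; lra.
Qed.

Let tanh_aux t : 0 < t -> 0 < expR (- (2 * t)) < 1.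
Proof. by move=> t0; rewrite expR_gt0 expR_lt1; lra. Qed.

Lemma tanh_gt0 t : 0 < t -> 0 < tanh t.
Proof.
by move=> /tanh_aux /andP[q0 q1]; rewrite /tanh divr_gt0//; lra.
Qed.

Lemma tanh_le1 t : 0 < t -> tanh t <= 1.
Proof.
move=> /tanh_aux /andP[q0 q1]; rewrite /tanh ler_pdivrMr; lra.
Qed.

Lemma tanh_le t : 0 < t -> tanh t <= 2 * t.
Proof.
move=> t0; have /andP[q0 q1] := tanh_aux t0.
rewrite /tanh ler_pdivrMr; last by lra.
have := expR_ge1Dx (- (2 * t)); move: (expR _) q0 q1 => q q0 q1.
by nra.
Qed.

Lemma tanh_ge t : 0 < t -> t <= 1 -> t / 3 <= tanh t.
Proof.
move=> t0 t1; have /andP[q0 q1] := tanh_aux t0.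
rewrite /tanh ler_pdivlMr; last by lra.
have h : expR (- (2 * t)) * (1 + 2 * t) <= 1.
  by rewrite expRN mulrC ler_pdivrMr ?expR_gt0// mul1r expR_ge1Dx.
by move: (expR _) q0 q1 h => q q0 q1 h; nra.
Qed.

Lemma tanh_ge_half t : 1 <= t -> 1 / 2 <= tanh t.
Proof.
move=> t1; have t0 : 0 < t by lra.
have /andP[q0 q1] := tanh_aux t0.
rewrite /tanh ler_pdivlMr; last by lra.
have h : expR (- (2 * t)) * (1 + 2 * t) <= 1.
  by rewrite expRN mulrC ler_pdivrMr ?expR_gt0// mul1r expR_ge1Dx.
by move: (expR _) q0 q1 h => q q0 q1 h; nra.
Qed.

End hyperbolic_bounds.

(** * Pointwise bounds for the derivatives of the kernel *)

Section kernel_bounds.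
Context (R : realType) (alpha : R) (j : nat).
Context (halpha : (exists2 i : nat, (i <= j)%N & alpha = i%:R - 1 / 2)
  \/ j%:R - 1 / 2 < alpha).
Implicit Types (t u v x : R) (i k m : nat).

Let a := alpha + 1 / 2.

Let ha : (exists2 i, (i <= j)%N & a = i%:R) \/ j%:R < a.
Proof.
by case: halpha => [[i ij E]|E]; [left; exists i; rewrite // /a E subrK|right; rewrite /a; lra].
Qed.

Let a_ge0 : 0 <= a.
Proof.
case: ha => [[i _ ->]|ja]; first exact: ler0n.
by rewrite ltW// (le_lt_trans _ ja).
Qed.

Let alpha1 : -1 < alpha.
Proof. by move: a_ge0; rewrite /a => ?; lra. Qed.

(** The bounds on (0,1] and [1,oo) are merged in two ways: decay in 1 + x for t <= 1, where each
    derivative must compensate a factor v/s, and vanishing order at 0 for t >= 1, where powers of s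
    must be gained. *)
Lemma bessel_profile_bounds : exists f C,
  [/\ chain j f, f 0%N = bessel_profile alpha, 0 <= C,
    (forall i x, (i <= j)%N -> 0 < x -> `|f i x| <= C * (1 + x) ^- i) &
    (forall i x, (i <= j)%N -> 0 < x -> `|f i x| <= C * x `^ Num.max (a - i%:R) 0)].
Proof.
have [f [cf f0 large small]] := bessel_profile_chain a_ge0 j.+2.
have [C C0 hC] := large j (leqnn _).
have [D D0 hD] := @uniform_bound R R (fun x => 0 < x /\ x <= 1) f
  (fun i x => x `^ Num.max (a - i%:R) 0) j (fun i x _ => powR_ge0 _ _)
  (fun i ij => let: ex_intro2 D D0 hD := small j i ha (leqW (leqW ij)) ij in
     ex_intro2 _ _ D D0 (fun x '(conj x0 x1) => hD x x0 x1)).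
pose K := 2 ^+ j * (C + D).
have K0 : 0 <= K by rewrite mulr_ge0 ?exprn_ge0 ?addr_ge0.
have two i : (i <= j)%N -> 2 ^+ i <= 2 ^+ j :> R by move=> ij; rewrite ler_weXn2l ?ler1n.
have CK : C <= K.
  by rewrite /K -[leLHS]mul1r ler_pM ?lerDl// -[leLHS](expr0 2) two.
have DK : D <= K.
  by rewrite /K -[leLHS]mul1r ler_pM ?lerDr// -[leLHS](expr0 2) two.
exists f, K; split => //; first exact: (chain_le (leqW (leqnSn j)) cf); move=> i x ij x0.
- have x10 : 0 < 1 + x by rewrite addr_gt0.
  rewrite ler_pdivlMr ?exprn_gt0//.
  have [x1|x1] := leP x 1.
    apply: (@le_trans _ _ (D * 2 ^+ i)).
      apply: ler_pM => //; first by rewrite exprn_ge0// ltW.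
        apply: le_trans (hD i x ij (conj x0 x1)) _; rewrite ler_piMr//.
        have M0 : 0 <= Num.max (a - i%:R) 0 by rewrite le_max lexx orbT.
        have := @ge0_ler_powR R _ M0 x 1; rewrite !nnegrE powR1.
        by apply => //; exact: ltW.
      by rewrite lerXn2r ?nnegrE ?(ltW x10)//; lra.
    by rewrite mulrC /K ler_pM ?exprn_ge0 ?two// lerDr.
  have xi : 0 < x ^+ i by rewrite exprn_gt0.
  apply: (@le_trans _ _ (C * x ^- i * (2 * x) ^+ i)).
    apply: ler_pM => //; first by rewrite exprn_ge0// ltW.
      by apply: hC => //; exact: ltW.
    by rewrite lerXn2r ?nnegrE ?(ltW x10) ?mulr_ge0 ?(ltW x0)//; lra.
  have -> : C * x ^- i * (2 * x) ^+ i = 2 ^+ i * C.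
    by rewrite exprMn; field; rewrite gt_eqF.
  by rewrite /K ler_pM ?exprn_ge0 ?two// lerDl.
- have [x1|x1] := leP x 1.
    apply: le_trans (hD i x ij (conj x0 x1)) _.
    by rewrite ler_wpM2r ?powR_ge0.
  apply: le_trans (hC i x ij (ltW x1)) _; apply: ler_pM => //.
    by rewrite invr_ge0 exprn_ge0// ltW.
  apply: (@le_trans _ _ 1); first by rewrite invf_le1 ?exprn_gt0// exprn_ege1// ltW.
  by rewrite -[leLHS](powRr0 x) ler_powR ?(ltW x1)// le_max lexx orbT.
Qed.

Definition gaussian t v u : R :=
  expR (- ((u - v) ^+ 2 / (2 * sinh2 t) + tanh t * (u ^+ 2 + v ^+ 2) / 2)).

Let is_derive_gaussian t v u : 0 < t -> is_derive u 1 (gaussian t v)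
  ((- (1 / sinh2 t + tanh t) * u + v / sinh2 t) * gaussian t v u).
Proof.
move=> t0; have s0 := sinh2_gt0 t0; rewrite /gaussian; move: (sinh2 t) s0 => s s0.
pose h y := - (1 / (2 * s) + tanh t / 2) * y ^+ 2 +
  (v / s * y + - (v ^+ 2 / (2 * s) + tanh t * v ^+ 2 / 2)).
have -> : (fun u => expR (- ((u - v) ^+ 2 / (2 * s) + tanh t * (u ^+ 2 + v ^+ 2) / 2)))
    = (fun u => expR (h u)).
  by apply/funext => y; rewrite /h; congr expR; field; rewrite gt_eqF.
have D : is_derive u 1 h (- (1 / (2 * s) + tanh t / 2) * (2 * u) + v / s).
  have D1 := is_deriveZ_fun (- (1 / (2 * s) + tanh t / 2)) (is_deriveX_fun 2 u).
  have D2 := is_derive_affine (v / s) (- (v ^+ 2 / (2 * s) + tanh t * v ^+ 2 / 2)) u.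
  by apply: (is_derive_eq (is_deriveD_fun D1 D2)); rewrite expr1.
apply: (is_derive_eq (is_derive_expR_comp D)).
have -> : h u = - ((u - v) ^+ 2 / (2 * s) + tanh t * (u ^+ 2 + v ^+ 2) / 2).
  by rewrite /h; field; rewrite gt_eqF.
by congr (_ * _); field; rewrite gt_eqF.
Qed.

(* [rho], [lam] and [om] are the size of the kernel, the size of one
   differentiation and the polynomial growth that the Gaussian absorbs. *)
Lemma kernel_derivative_bound (c K kap : R) f t u v (rho lam om : R) (N : nat) :
  chain j f -> f 0%N = bessel_profile alpha -> 0 <= c ->
  (forall t u v, 0 < t -> 0 < u -> 0 < v -> heat_kernel alpha t u v =
    c * sinh2 t `^ (- (1 / 2)) * (bessel_profile alpha (u * v / sinh2 t) * gaussian t v u)) ->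
  0 < t -> 0 < u -> 0 < v -> 0 <= kap -> 0 <= K -> 0 <= lam -> 1 <= om -> 0 <= rho ->
  (forall i, (i <= j)%N -> sinh2 t `^ (- (1 / 2)) *
     `|(v / sinh2 t) ^+ i * f i (u * v / sinh2 t)| <= K * rho * lam ^+ i * om ^+ N) ->
  `| - (1 / sinh2 t + tanh t) * u + v / sinh2 t | <= kap * (lam * om) ->
  1 / sinh2 t + tanh t <= kap * lam ^+ 2 ->
  `|du_heat_kernel alpha j t u v| <=
  c * (2 ^+ j * K * \sum_(0 <= k < j.+1) gaussian_factor kap kap k)
    * (rho * lam ^+ j * om ^+ (N + j) * gaussian t v u).
Proof.
move=> cf f0 c0 kernelE t0 u0 v0 kap0 K0 lam0 om1 rho0 hA hl hm.
set s := sinh2 t; have s0 : 0 < s by exact: sinh2_gt0.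
have om0 : 0 <= om by exact: le_trans om1.
pose A i y := (v / s) ^+ i * f i (y * v / s).
have cA : chain j A.
  move=> i ij y y0; rewrite /A.
  have D : is_derive y 1 (fun y : R => y * v / s) (v / s).
    have := is_deriveZ_fun (v / s) (is_derive_id_fun y); rewrite mulr1.
    by under eq_fun do rewrite mulrC mulrA.
  have yvs : 0 < y * v / s by rewrite divr_gt0// mulr_gt0.
  have D2 := @is_derive1_comp R (f i) (fun y => y * v / s) y _ _ (cf i ij _ yvs) D.
  apply: (is_derive_eq (is_deriveZ_fun _ D2)).
  by rewrite exprS; ring.
pose E i y := gaussian_factor (- (1 / s + tanh t)) (- (1 / s + tanh t) * y + v / s) i
  * gaussian t v y.
have cE : chain j E by apply: chain_gaussian => y; exact: is_derive_gaussian.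
pose kk i y := (c * s `^ (- (1 / 2))) * leibniz A E i y.
have ck : chain j kk.
  by move=> i ij y y0; apply: is_deriveZ_fun; exact: (chain_leibniz cA cE).
have -> : du_heat_kernel alpha j t u v = kk j u.
  (* The chain must start with the kernel itself, with which [kk 0] agrees only at positive
     points. *)
  pose k' i := if i is 0%N then (fun y => heat_kernel alpha t y v) else kk i.
  have k0 y : 0 < y -> kk 0%N y = heat_kernel alpha t y v.
    move=> y0; rewrite kernelE// /kk leibniz0 /A /E f0 expr0 -/s.
    by rewrite [gaussian_factor _ _ 0]/= !mul1r.
  have ck' : chain j k'.
    move=> [|i] ij y y0; last exact: ck.
    by apply: (eq_is_derive_pos k0 y0); exact: ck.
  have -> : kk j u = k' j u by rewrite /k'; case: (j) => [|//]; rewrite k0.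
  exact: (chain_derive1n ck').
set S := s `^ (- (1 / 2)) in hA *; have S0 : 0 < S by rewrite powR_gt0.
pose Gs := \sum_(0 <= k < j.+1) gaussian_factor kap kap k.
pose D := K * Gs * (rho * lam ^+ j * om ^+ (N + j) * gaussian t v u).
have g0 : 0 <= gaussian t v u by exact: expR_ge0.
have L : `|leibniz A E j u| <= 2 ^+ j * (D / S).
  apply: leibniz_le => i k ik.
  have ij : (i <= j)%N by rewrite -ik leq_addr.
  have kj : (k <= j)%N by rewrite -ik leq_addl.
  rewrite ler_pdivlMr// mulrC mulrA.
  have hE : `|E k u| <= gaussian_factor kap kap k * (lam * om) ^+ k * gaussian t v u.
    rewrite normrM [`|gaussian _ _ _|]ger0_norm// ler_wpM2r//.
    apply: gaussian_factor_le => //; rewrite normrN ger0_norm//.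
    by apply: addr_ge0; [rewrite divr_ge0// ltW|exact/ltW/tanh_gt0].
  apply: le_trans (ler_pM _ _ (hA i ij) hE) _ => //.
    by rewrite mulr_ge0// ltW.
  have gk : gaussian_factor kap kap k <= Gs.
    rewrite /Gs big_mkord (bigD1 (Ordinal (n := j.+1) (m := k) kj))//= lerDl.
    by apply: sumr_ge0 => l _; exact: gaussian_factor_ge0.
  have gk0 : 0 <= gaussian_factor kap kap k by exact: gaussian_factor_ge0.
  have -> : K * rho * lam ^+ i * om ^+ N *
      (gaussian_factor kap kap k * (lam * om) ^+ k * gaussian t v u) =
      (K * gaussian_factor kap kap k) *
      (rho * lam ^+ j * om ^+ (N + k) * gaussian t v u).
    by rewrite -ik [lam ^+ (i + k)]exprD [om ^+ (N + k)]exprD exprMn; ring.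
  rewrite /D; apply: ler_pM.
  - exact: mulr_ge0.
  - by rewrite !mulr_ge0 ?exprn_ge0.
  - by rewrite ler_wpM2l.
  - rewrite ler_wpM2r// ler_wpM2l ?mulr_ge0 ?exprn_ge0// ler_weXn2l//.
    by rewrite leq_add2l.
rewrite /kk -/S normrM ger0_norm; last by rewrite mulr_ge0// ltW.
apply: le_trans (ler_wpM2l _ L) _; first by rewrite mulr_ge0// ltW.
rewrite le_eqVlt; apply/orP; left; apply/eqP.
rewrite /D /Gs; move: (\sum_(0 <= k < j.+1) _) (gaussian t v u) => G g.
by move: (2 ^+ j) (lam ^+ j) (om ^+ _) => p l o; field; rewrite gt_eqF.
Qed.

(* For [u < v / 2] use [|u - v| >= v / 2], otherwise
   [2 (r^2 + u v) >= 2 r^2 + v^2 >= v r]. *)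
Let ratio_le (r u v : R) : 0 < r -> 0 < u -> 0 < v ->
  v * r ^+ 2 <= 2 * (r ^+ 2 + u * v) * (r + `|u - v|).
Proof.
move=> r0 u0 v0; have d0 := normr_ge0 (u - v).
have uv : v - `|u - v| <= u.
  by have := ler_norm (v - u); rewrite distrC; lra.
move: (`|u - v|) d0 uv => d d0 uv.
have uv0 : 0 < u * v by exact: mulr_gt0.
have r20 : 0 < r ^+ 2 by rewrite exprn_gt0.
have [h|h] := leP (v / 2) d.
  have : v * r ^+ 2 <= 2 * r ^+ 2 * d by nra.
  by nra.
have h2 : v ^+ 2 / 2 <= u * v by nra.
have h3 : v * r <= 2 * r ^+ 2 + v ^+ 2.
  by have := sqr_ge0 (v - r / 2); nra.
have h4 : v * r * r <= (2 * r ^+ 2 + v ^+ 2) * r by rewrite ler_wpM2r// ltW.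
have h5 : 2 * r ^+ 2 + v ^+ 2 <= 2 * (r ^+ 2 + u * v) by lra.
apply: (@le_trans _ _ (2 * (r ^+ 2 + u * v) * r)).
  rewrite expr2 mulrA; apply: le_trans h4 _.
  by rewrite ler_wpM2r// ltW.
by rewrite ler_wpM2l ?lerDl// mulr_ge0// addr_ge0// ltW.
Qed.

(** One differentiation costs 1/r with r = sqrt t. The quantities |u-v|/s from the square, u from
    tanh t and v/(s+uv) from the profile are each at most a multiple of [om] / r, with [om] = 1 +
    |u-v|/r + r u. *)
Lemma heat_kernel_bound_small : exists c C : R, [/\ 0 < c, 0 <= C, c <= 1 / 8 &
  forall u v t, 0 < u -> 0 < v -> 0 < t -> t <= 1 ->
  `|du_heat_kernel alpha j t u v| <=
  C * (t `^ (- ((j%:R + 1) / 2)) * expR (- c * ((u - v) ^+ 2 / t)))].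
Proof.
have [c0 c00 kernelE] := heat_kernelE alpha1.
have [f [C0 [cf f0 C00 fC _]]] := bessel_profile_bounds.
pose e2 : R := expR 2.
have e23 : 3 <= e2 by have := expR_ge1Dx (2 : R); rewrite /e2; lra.
(* Chosen so that s <= 2 e^2 t gives 1/(2s) >= 2 eps/t; also 2 eps <= 1/6, as needed for the tanh
   part. *)
pose eps := (8 * e2)^-1.
have eps0 : 0 < eps by rewrite invr_gt0; lra.
have [P P0 hP] := expn_le_gauss (j + j) eps0.
pose Gs : R := \sum_(0 <= k < j.+1) gaussian_factor 2 2 k.
have Gs0 : 0 <= Gs by apply: sumr_ge0 => k _; exact: gaussian_factor_ge0.
exists eps, (c0 * (2 ^+ j * (C0 * 2 ^+ j) * Gs) * P); split => //.
- by rewrite !mulr_ge0 ?exprn_ge0.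
- by rewrite /eps invf_ple ?posrE//; lra.
move=> u v t u0 v0 t0 t1.
pose r := Num.sqrt t; have r0 : 0 < r by rewrite sqrtr_gt0.
have r2 : r ^+ 2 = t by rewrite sqr_sqrtr// ltW.
have r1 : r <= 1 by rewrite -sqrtr1 ler_wsqrtr.
have tr : t <= r by rewrite -r2 expr2 ler_piMr// ltW.
set s := sinh2 t; have s0 : 0 < s by exact: sinh2_gt0.
have ts : t <= s by apply: sinh2_ge; exact: ltW.
pose d := `|u - v|; have d0 : 0 <= d by exact: normr_ge0.
pose om := 1 + d / r + r * u.
have dr0 : 0 <= d / r by rewrite divr_ge0// ltW.
have ru0 : 0 <= r * u by rewrite mulr_ge0 ?(ltW r0) ?(ltW u0).
have om1 : 1 <= om by rewrite /om; lra.
have rV0 : 0 <= r^-1 by rewrite invr_ge0 ltW.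
have sr : s `^ (- (1 / 2)) <= r^-1.
  rewrite powRN mul1r powR12_sqrt ?(ltW s0)// lef_pV2 ?posrE ?sqrtr_gt0//.
  exact: ler_wsqrtr.
have ratio : v / s / (1 + u * v / s) <= 2 * (r^-1 * om).
  have uv0 : 0 < u * v by exact: mulr_gt0.
  have -> : v / s / (1 + u * v / s) = v / (s + u * v).
    by field; rewrite !gt_eqF// addr_gt0.
  apply: (@le_trans _ _ (v / (r ^+ 2 + u * v))).
    rewrite ler_wpM2l ?(ltW v0)// lef_pV2 ?posrE ?addr_gt0 ?exprn_gt0//.
    by rewrite lerD2r r2.
  apply: (@le_trans _ _ (2 * (r^-1 * (1 + d / r)))); last first.
    by rewrite !ler_wpM2l// /om; lra.
  rewrite ler_pdivrMr ?addr_gt0 ?exprn_gt0//.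
  have -> : 2 * (r^-1 * (1 + d / r)) * (r ^+ 2 + u * v) =
      (2 * (r ^+ 2 + u * v) * (r + d)) / r ^+ 2.
    by field; rewrite gt_eqF.
  by rewrite ler_pdivlMr ?exprn_gt0// ratio_le.
have hA i : (i <= j)%N -> s `^ (- (1 / 2)) *
     `|(v / s) ^+ i * f i (u * v / s)| <= C0 * 2 ^+ j * r^-1 * r^-1 ^+ i * om ^+ j.
  move=> ij; have x0 : 0 < u * v / s by rewrite divr_gt0// mulr_gt0.
  have vs0 : 0 <= v / s by rewrite divr_ge0// ltW.
  apply: (@le_trans _ _ (r^-1 * (C0 * (2 * (r^-1 * om)) ^+ i))).
    apply: ler_pM => //; first exact: powR_ge0.
    rewrite normrM ger0_norm ?exprn_ge0//.
    apply: (@le_trans _ _ ((v / s) ^+ i * (C0 * (1 + u * v / s) ^- i))).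
      by rewrite ler_wpM2l ?exprn_ge0// fC.
    rewrite mulrCA ler_wpM2l// -exprVn -exprMn lerXn2r ?nnegrE//.
      by rewrite mulr_ge0// invr_ge0 addr_ge0// ltW.
    by rewrite mulr_ge0// mulr_ge0// (le_trans _ om1).
  have -> : r^-1 * (C0 * (2 * (r^-1 * om)) ^+ i) =
      C0 * 2 ^+ i * r^-1 * r^-1 ^+ i * om ^+ i by rewrite !exprMn; ring.
  apply: ler_pM; rewrite ?mulr_ge0 ?exprn_ge0 ?(le_trans _ om1)//.
    rewrite !ler_wpM2r ?exprn_ge0//.
    by rewrite ler_wpM2l// ler_weXn2l// ler1n.
  by rewrite ler_weXn2l.
have tau0 := tanh_gt0 t0; have tau2 := tanh_le t0; have tau1 := tanh_le1 t0.
have sV : s^-1 <= r^-1 ^+ 2.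
  by rewrite exprVn r2 lef_pV2.
have sV0 : 0 <= s^-1 by rewrite invr_ge0 ltW.
have rr1 : 1 <= r^-1 by rewrite invf_ge1.
have hm : 1 / s + tanh t <= 2 * r^-1 ^+ 2.
  have : 1 <= r^-1 ^+ 2 by rewrite exprn_ege1.
  by rewrite mul1r; lra.
have hl : `| - (1 / s + tanh t) * u + v / s | <= 2 * (r^-1 * om).
  have -> : - (1 / s + tanh t) * u + v / s = - ((u - v) / s) - tanh t * u.
    by field; rewrite gt_eqF.
  apply: le_trans (ler_normB _ _) _.
  rewrite normrN [`|(u - v) / s|]normrM -/d (ger0_norm sV0).
  rewrite [`|tanh t * u|]normrM (gtr0_norm tau0) (gtr0_norm u0).
  have h1 : d * s^-1 <= d / r * r^-1.
    by rewrite -mulrA -expr2 ler_wpM2l.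
  have h2 : tanh t * u <= 2 * u.
    by rewrite ler_wpM2r ?(ltW u0)//; lra.
  have h3 : 2 * (r^-1 * om) = 2 * r^-1 + 2 * (d / r * r^-1) + 2 * u.
    by rewrite /om; field; rewrite gt_eqF.
  have h4 : 0 <= d / r * r^-1 by rewrite mulr_ge0.
  by rewrite h3; lra.
have k20 : 0 <= 2 :> R by [].
have K0 : 0 <= C0 * 2 ^+ j by rewrite mulr_ge0 ?exprn_ge0.
have B := @kernel_derivative_bound c0 (C0 * 2 ^+ j) 2 f t u v r^-1 r^-1 om j
  cf f0 c00 kernelE t0 u0 v0 k20 K0 rV0 om1 rV0 hA hl hm.
apply: le_trans B _; rewrite -/Gs -[leRHS]mulrA ler_wpM2l ?mulr_ge0 ?exprn_ge0//.
(* Of the rate 2 eps, one eps absorbs the power of [om] and the other remains in the estimate. *)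
have gE : gaussian t v u <= expR (- (2 * eps * ((d / r) ^+ 2 + (r * u) ^+ 2))).
  rewrite /gaussian ler_expR lerN2 -/s mulrDr lerD//.
    have -> : (d / r) ^+ 2 = (u - v) ^+ 2 / t.
      by rewrite expr_div_n r2 /d real_normK// num_real.
    rewrite mulrCA ler_wpM2l ?sqr_ge0//.
    have st : s <= 2 * e2 * t by apply: sinh2_le => //; exact: ltW.
    have -> : 2 * eps / t = (2 * (2 * e2 * t))^-1.
      by rewrite /eps; field; rewrite !gt_eqF//; lra.
    have e20 : 0 < e2 by lra.
    have p1 : 0 < 2 * (2 * e2 * t) by rewrite !mulr_gt0.
    have p2 : 0 < 2 * s by exact: mulr_gt0.
    by rewrite lef_pV2 ?posrE// ler_pM2l.
  have th := tanh_ge t0 t1; rewrite -/s in th *.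
  have e12 : 2 * eps <= 1 / 6.
    have -> : 2 * eps = (4 * e2)^-1 by rewrite /eps; field; rewrite gt_eqF//; lra.
    by rewrite invf_ple ?posrE//; lra.
  rewrite exprMn r2.
  have u2 : 0 <= u ^+ 2 by exact: sqr_ge0.
  have v2 : 0 <= v ^+ 2 by exact: sqr_ge0.
  have tu : 0 <= t * u ^+ 2 by rewrite mulr_ge0// ltW.
  apply: (@le_trans _ _ (1 / 6 * (t * u ^+ 2))); first by rewrite ler_wpM2r.
  have : t / 3 * (u ^+ 2 + v ^+ 2) <= tanh t * (u ^+ 2 + v ^+ 2).
    by rewrite ler_wpM2r// addr_ge0.
  have : 0 <= t * v ^+ 2 by rewrite mulr_ge0// ltW.
  by lra.
have rj : r^-1 * r^-1 ^+ j = t `^ (- ((j%:R + 1) / 2)).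
  rewrite -exprS exprVn powRN; congr (_^-1).
  rewrite natr1 mulrC powRrM powR12_sqrt ?(ltW t0)// -/r.
  by rewrite powR_mulrn// ltW.
rewrite -rj.
have -> : r^-1 * r^-1 ^+ j * om ^+ (j + j) * gaussian t v u =
  (r^-1 * r^-1 ^+ j) * (om ^+ (j + j) * gaussian t v u) by ring.
rewrite [leRHS]mulrCA ler_wpM2l ?mulr_ge0 ?exprn_ge0//.
apply: (@le_trans _ _ (P * expR (eps * ((d / r) ^+ 2 + (r * u) ^+ 2)) *
  expR (- (2 * eps * ((d / r) ^+ 2 + (r * u) ^+ 2))))).
  by apply: ler_pM; rewrite ?exprn_ge0 ?expR_ge0 ?(le_trans _ om1)// hP.
rewrite -mulrA -expRD ler_wpM2l// ler_expR.
have -> : (u - v) ^+ 2 / t = (d / r) ^+ 2.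
  by rewrite expr_div_n r2 /d real_normK// num_real.
have : 0 <= eps * (r * u) ^+ 2 by rewrite mulr_ge0 ?sqr_ge0// ltW.
by lra.
Qed.

(** Here a differentiation costs no power of t, and the factor exp(-2t(alpha+1)) comes entirely from
    powers of s. *)
Lemma heat_kernel_bound_large : exists2 C : R, 0 <= C &
  forall u v t, 0 < u -> 0 < v -> 1 <= t ->
  `|du_heat_kernel alpha j t u v| <=
  C * (expR (- 2 * t * (alpha + 1)) * expR (- (1 / 8) * (u - v) ^+ 2)).
Proof.
have [c0 c00 kernelE] := heat_kernelE alpha1.
have [f [C0 [cf f0 C00 _ fC]]] := bessel_profile_bounds.
(* Bounds the degree i + 2M of v^i (uv)^M, where M = max(a-i, 0) <= a. *)
pose N := (Num.truncn (2 * a + j%:R)).+1.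
have aN : 2 * a + j%:R <= N%:R.
  by apply/ltW/truncnS_gt; rewrite addr_ge0// mulr_ge0.
have eps0 : 0 < 1 / 8 :> R by lra.
have [P P0 hP] := expn_le_gauss (N + j) eps0.
pose Gs : R := \sum_(0 <= k < j.+1) gaussian_factor 2 2 k.
have Gs0 : 0 <= Gs by apply: sumr_ge0 => k _; exact: gaussian_factor_ge0.
pose K := C0 * 4 `^ (alpha + 1).
have K0 : 0 <= K by rewrite mulr_ge0 ?powR_ge0.
exists (c0 * (2 ^+ j * K * Gs) * P); first by rewrite !mulr_ge0 ?exprn_ge0.
move=> u v t u0 v0 t1; have t0 : 0 < t by exact: lt_le_trans t1.
set s := sinh2 t; have s0 : 0 < s by exact: sinh2_gt0.
have s1 : 1 <= s by apply: le_trans t1 _; apply: sinh2_ge; exact: ltW.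
have uv0 : 0 < u * v by exact: mulr_gt0.
pose om := 1 + u + v.
have om1 : 1 <= om by rewrite /om; lra.
have om0 : 0 < om by exact: lt_le_trans om1.
pose rho := expR (- 2 * t * (alpha + 1)).
have rho0 : 0 <= rho by exact: expR_ge0.
have alpha10 : 0 <= alpha + 1 by rewrite -lerBlDr sub0r ltW.
(* The constant 4^(alpha+1) comes from s >= exp(2t)/4. *)
have sK : s `^ (- (alpha + 1)) <= 4 `^ (alpha + 1) * rho.
  have e4 : 0 < expR (2 * t) / 4 by rewrite divr_gt0 ?expR_gt0.
  rewrite powRN; apply: (@le_trans _ _ ((expR (2 * t) / 4) `^ (alpha + 1))^-1).
    rewrite lef_pV2 ?posrE ?powR_gt0// ge0_ler_powR ?nnegrE ?(ltW e4) ?(ltW s0)//.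
    exact: sinh2_ge_expR.
  rewrite powRM ?expR_ge0 ?invr_ge0// -expRM invfM mulrC.
  have -> : 4^-1 `^ (alpha + 1) = (4 `^ (alpha + 1))^-1 :> R.
    by rewrite -powR_inv1// -powRrM mulN1r powRN.
  rewrite invrK -expRN /rho le_eqVlt; apply/orP; left; apply/eqP.
  by congr (_ * expR _); ring.
have hA i : (i <= j)%N -> s `^ (- (1 / 2)) *
     `|(v / s) ^+ i * f i (u * v / s)| <= K * rho * 1 ^+ i * om ^+ N.
  move=> ij; pose M := Num.max (a - i%:R) 0.
  have M0 : 0 <= M by rewrite /M le_max lexx orbT.
  have Ma : M <= a by rewrite /M ge_max a_ge0 andbT lerBlDr lerDl.
  have iM : a <= i%:R + M by rewrite -lerBlDl /M le_max lexx.
  have x0 : 0 < u * v / s by exact: divr_gt0.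
  have vs0 : 0 <= v / s by rewrite divr_ge0// ltW.
  apply: (@le_trans _ _ (s `^ (- (1 / 2)) * ((v / s) ^+ i * (C0 * (u * v / s) `^ M)))).
    rewrite ler_wpM2l ?powR_ge0// normrM ger0_norm ?exprn_ge0//.
    by rewrite ler_wpM2l ?exprn_ge0// fC.
  have -> : s `^ (- (1 / 2)) * ((v / s) ^+ i * (C0 * (u * v / s) `^ M)) =
      C0 * (s `^ (- (1 / 2 + i%:R + M)) * (v ^+ i * (u * v) `^ M)).
    have -> : (u * v / s) `^ M = (u * v) `^ M * s `^ (- M).
      rewrite powRM ?(ltW uv0) ?invr_ge0 ?(ltW s0)//; congr (_ * _).
      by rewrite -powR_inv1 ?(ltW s0)// -powRrM mulN1r.
    have -> : (v / s) ^+ i = v ^+ i * s `^ (- i%:R).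
      by rewrite expr_div_n powR_invn// ltW.
    have -> : - (1 / 2 + i%:R + M) = - (1 / 2) + - i%:R + - M by ring.
    have sn0 : s != 0 by rewrite gt_eqF.
    by rewrite !powRD ?sn0 ?implybT//; ring.
  have vom : v <= om by rewrite /om; lra.
  have h1 : v ^+ i * (u * v) `^ M <= om ^+ N.
    apply: (@le_trans _ _ (om `^ (i%:R + 2 * M))).
      rewrite powRD; last by rewrite (gt_eqF om0) implybT.
      rewrite powR_mulrn ?(ltW om0)// powRrM; apply: ler_pM; rewrite ?powR_ge0//.
        by rewrite exprn_ge0// ltW.
      - by rewrite lerXn2r ?nnegrE// ltW.
      - apply: ge0_ler_powR => //; rewrite ?nnegrE ?powR_ge0// ?(ltW uv0)//.
        rewrite powR_mulrn ?(ltW om0)// /om; nra.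
    rewrite -powR_mulrn ?(ltW om0)//; apply: ler_powR => //.
    apply: le_trans aN; have : i%:R <= j%:R :> R by rewrite ler_nat.
    by lra.
  (* As s >= 1, it suffices that 1/2 + i + M >= 1/2 + a = alpha + 1. *)
  have h2 : s `^ (- (1 / 2 + i%:R + M)) <= 4 `^ (alpha + 1) * rho.
    apply: le_trans sK; apply: ler_powR => //.
    by rewrite lerN2; move: iM; rewrite /a; lra.
  rewrite expr1n mulr1 /K -[C0 * _ * rho]mulrA -[leRHS]mulrA ler_wpM2l//.
  apply: ler_pM => //; first exact: powR_ge0.
  by rewrite mulr_ge0 ?powR_ge0// exprn_ge0// ltW.
have tau0 := tanh_gt0 t0; have tau1 := tanh_le1 t0; have tau2 := tanh_ge_half t1.
have sV1 : s^-1 <= 1 by rewrite invf_le1.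
have sV0 : 0 <= s^-1 by rewrite invr_ge0 ltW.
have hm : 1 / s + tanh t <= 2 * 1 ^+ 2.
  by rewrite mul1r expr1n mulr1; lra.
have hl : `| - (1 / s + tanh t) * u + v / s | <= 2 * (1 * om).
  have h1 : v / s <= v by rewrite ler_piMr// ltW.
  have h2 : (1 / s + tanh t) * u <= 2 * u.
    by rewrite ler_wpM2r ?(ltW u0)//; move: hm; rewrite expr1n mulr1.
  have h3 : 0 <= v / s by rewrite divr_ge0// ltW.
  have h4 : 0 <= (1 / s + tanh t) * u.
    by rewrite mulr_ge0 ?(ltW u0)// mul1r; lra.
  by rewrite mul1r ler_norml /om; apply/andP; split; lra.
have k20 : 0 <= 2 :> R by [].
have B := @kernel_derivative_bound c0 K 2 f t u v rho 1 om N
  cf f0 c00 kernelE t0 u0 v0 k20 K0 ler01 om1 rho0 hA hl hm.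
apply: le_trans B _; rewrite -/Gs -[leRHS]mulrA ler_wpM2l ?mulr_ge0 ?exprn_ge0//.
(* The tanh part alone gives the rate 1/4. Half of it absorbs the power of [om]; since uv >= 0, the
   other half gives exp(-(u-v)^2/8). *)
have gE : gaussian t v u <= expR (- (1 / 4 * (u ^+ 2 + v ^+ 2))).
  rewrite /gaussian ler_expR lerN2 -/s.
  have h : 0 <= (u - v) ^+ 2 / (2 * s) by rewrite divr_ge0 ?sqr_ge0// mulr_ge0// ltW.
  have h2 : 0 <= u ^+ 2 + v ^+ 2 by rewrite addr_ge0 ?sqr_ge0.
  have h3 : 1 / 2 * (u ^+ 2 + v ^+ 2) <= tanh t * (u ^+ 2 + v ^+ 2).
    by rewrite ler_wpM2r.
  by lra.
rewrite expr1n mulr1 -mulrA -/rho [leRHS]mulrCA ler_wpM2l//.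
apply: (@le_trans _ _ (P * expR (1 / 8 * (u ^+ 2 + v ^+ 2)) *
  expR (- (1 / 4 * (u ^+ 2 + v ^+ 2))))).
  by apply: ler_pM; rewrite ?exprn_ge0 ?expR_ge0 ?(ltW om0)// hP// ltW.
rewrite -mulrA -expRD ler_wpM2l// ler_expR.
have : 0 <= u * v by exact: ltW.
by rewrite sqrrB; lra.
Qed.

End kernel_bounds.

(** * L^2 norms *)

Section l2_norm.
Context (R : realType).
Notation mu := (@lebesgue_measure R).

(* No measurability of [f] is needed: the integral of a nonnegative function is a
   supremum over the simple functions below it. *)
Lemma ge0_le_integral_nonmeasurable (f g : R -> \bar R) :
  (forall x, 0 <= f x)%E -> (forall x, f x <= g x)%E ->
  (\int[mu]_x f x <= \int[mu]_x g x)%E.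
Proof.
move=> f0 fg; have g0 x : (0 <= g x)%E by exact: le_trans (f0 x) (fg x).
rewrite !ge0_integralTE//; apply: le_ereal_sup => _ [h hf <-].
by exists h => // x; apply: le_trans (hf x) (fg x).
Qed.

(** The integrand is a multiple of the normal density with mean m and variance 1/(2c). *)
Lemma integral_gaussian (c m : R) : 0 < c ->
  (\int[mu]_x (expR (- c * (m - x) ^+ 2))%:E = (Num.sqrt (pi / c))%:E)%E.
Proof.
move=> c0; pose sigma := Num.sqrt ((2 * c)^-1).
have c20 : 0 < (2 * c)^-1 by rewrite invr_gt0 mulr_gt0.
have sigma0 : sigma != 0 by rewrite gt_eqF// sqrtr_gt0.
have sigma2 : sigma ^+ 2 = (2 * c)^-1 by rewrite sqr_sqrtr// ltW.
have peak : normal_peak sigma = (Num.sqrt (pi / c))^-1.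
  rewrite /normal_peak sigma2; congr (Num.sqrt _)^-1.
  by rewrite -mulr_natr; field; rewrite gt_eqF.
have p0 : 0 < Num.sqrt (pi / c) by rewrite sqrtr_gt0 divr_gt0 ?pi_gt0.
have E x : (expR (- c * (m - x) ^+ 2))%:E =
    ((Num.sqrt (pi / c))%:E * (normal_pdf m sigma x)%:E)%E.
  rewrite normal_pdfE//= peak -EFinM [in RHS]mulrA mulfV ?mul1r ?gt_eqF//.
  rewrite /normal_fun sigma2; congr (expR _)%:E.
  by rewrite -mulr_natr; field; rewrite gt_eqF.
under eq_integral do rewrite E.
rewrite ge0_integralZl_EFin ?integral_normal_pdf ?mule1// ?ltW//.
- by move=> x _; rewrite lee_fin normal_pdf_ge0.
- by apply/measurable_EFinP; exact: measurable_normal_pdf.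
Qed.

(** The squared majorant has rate 2c and integral B^2 sqrt(pi/(2c)) over the whole line; the outer
    square root leaves the exponent 1/4. *)
Lemma L2norm_pos_gaussian (f : R -> R) (B c m : R) : 0 <= B -> 0 < c ->
  (forall v, 0 < v -> `|f v| <= B * expR (- c * (m - v) ^+ 2)) ->
  (L2norm_pos f <= (B * (pi / (2 * c)) `^ (1 / 4))%:E)%E.
Proof.
move=> B0 c0 fB.
have c20 : 0 < 2 * c by exact: mulr_gt0.
pose g : R -> R := f \_ `]0, +oo[.
have I : (\int[mu]_x (`|(EFin \o g) x| `^ 2) <=
    (B ^+ 2 * Num.sqrt (pi / (2 * c)))%:E)%E.
  apply: (@le_trans _ _ (\int[mu]_x (B ^+ 2 * expR (- (2 * c) * (m - x) ^+ 2))%:E)%E).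
    apply: ge0_le_integral_nonmeasurable => x; first exact: poweR_ge0.
    rewrite /= lee_fin (powR_mulrn 2)//.
    have -> : B ^+ 2 * expR (- (2 * c) * (m - x) ^+ 2) =
        (B * expR (- c * (m - x) ^+ 2)) ^+ 2.
      by rewrite exprMn -expRM_natr; congr (_ * expR _); ring.
    rewrite lerXn2r ?nnegrE ?mulr_ge0 ?expR_ge0//.
    rewrite /g patchE; case: ifPn => [|_].
      by rewrite inE/= in_itv/= andbT; exact: fB.
    by rewrite normr0 mulr_ge0 ?expR_ge0.
  under eq_integral do rewrite EFinM.
  rewrite ge0_integralZl_EFin ?sqr_ge0//.
  - by rewrite integral_gaussian.
  - apply/measurable_EFinP; apply: measurableT_comp => //.
    apply: measurable_funM => //; apply: measurable_funX.
    exact: measurable_funB.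
rewrite /L2norm_pos Lnorm.unlock -/g.
have I0 : (0 <= \int[mu]_x (`|(EFin \o g) x| `^ 2))%E.
  by apply: integral_ge0 => x _; exact: poweR_ge0.
have S0 : 0 <= Num.sqrt (pi / (2 * c)) by exact: sqrtr_ge0.
apply: (@le_trans _ _ ((B ^+ 2 * Num.sqrt (pi / (2 * c)))%:E `^ 2^-1)%E).
  by apply: gt0_ler_poweR => //; rewrite ?in_itv/= ?leey ?andbT ?lee_fin ?mulr_ge0 ?sqr_ge0.
rewrite poweR_EFin lee_fin powRM ?sqr_ge0// powR12_sqrt ?sqr_ge0// sqrtr_sqr ger0_norm//.
have p0 : 0 <= pi / (2 * c) :> R by rewrite divr_ge0 ?pi_ge0// ltW.
rewrite -(powR12_sqrt p0) -powRrM.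
by have -> : 2^-1 * 2^-1 = 1 / 4 :> R by field.
Qed.

End l2_norm.

Theorem lemma4p10 (R : realType) (j : nat) (alpha : R)
    (halpha : (exists2 i : nat, (i <= j)%N & alpha = i%:R - 1 / 2)
              \/ j%:R - 1 / 2 < alpha) :
  (exists c C : R, [/\ 0 < c, 0 < C &
     forall u v t : R, 0 < u -> 0 < v -> 0 < t ->
       (t <= 1 ->
          `|du_heat_kernel alpha j t u v|
            <= C * (t `^ (- ((j%:R + 1) / 2)) * expR (- c * ((u - v) ^+ 2 / t))))
       /\
       (1 <= t ->
          `|du_heat_kernel alpha j t u v|
            <= C * (expR (- 2 * t * (alpha + 1)) * expR (- c * (u - v) ^+ 2)))])
  /\
  (exists C' : R,
     forall t : R, 0 < t ->
       (t <= 1 ->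
          (ereal_sup [set L2norm_pos (du_heat_kernel alpha j t u)
                     | u in `]0%R, +oo[ ]
             <= (C' * t `^ (- ((2 * j%:R + 1) / 4)))%:E)%E)
       /\
       (1 <= t ->
          (ereal_sup [set L2norm_pos (du_heat_kernel alpha j t u)
                     | u in `]0%R, +oo[ ]
             <= (C' * expR (- 2 * t * (alpha + 1)))%:E)%E)).
Proof.
have [c [C1 [c0 C10 c8 small]]] := heat_kernel_bound_small halpha.
have [C2 C20 large] := heat_kernel_bound_large halpha.
(* The summand 1 makes C strictly positive. *)
pose C := C1 + C2 + 1.
have C0 : 0 < C by rewrite /C; lra.
have smallC u v t : 0 < u -> 0 < v -> 0 < t -> t <= 1 ->
    `|du_heat_kernel alpha j t u v| <=
    C * (t `^ (- ((j%:R + 1) / 2)) * expR (- c * ((u - v) ^+ 2 / t))).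
  move=> u0 v0 t0 t1; apply: le_trans (small u v t u0 v0 t0 t1) _.
  by rewrite ler_wpM2r ?mulr_ge0 ?powR_ge0 ?expR_ge0// /C; lra.
have largeC u v t : 0 < u -> 0 < v -> 1 <= t ->
    `|du_heat_kernel alpha j t u v| <=
    C * (expR (- 2 * t * (alpha + 1)) * expR (- c * (u - v) ^+ 2)).
  move=> u0 v0 t1; apply: le_trans (large u v t u0 v0 t1) _.
  apply: ler_pM; rewrite ?mulr_ge0 ?expR_ge0//; first by rewrite /C; lra.
  (* Since c <= 1/8, the Gaussian rate of the range t <= 1 also serves for t >= 1. *)
  rewrite ler_wpM2l ?expR_ge0// ler_expR !mulNr lerN2.
  by rewrite ler_wpM2r ?sqr_ge0.
split.
  exists c, C; split => // u v t u0 v0 t0; split => t1; first exact: smallC.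
  exact: largeC.
pose K := C * (pi / (2 * c)) `^ (1 / 4).
exists K => t t0; split => t1; apply: ge_ereal_sup => _ [u uI <-];
  have u0 : 0 < u by rewrite (itvP uI).
- have ct : 0 < c / t by exact: divr_gt0.
  apply: le_trans (L2norm_pos_gaussian (f := du_heat_kernel alpha j t u)
    (B := C * t `^ (- ((j%:R + 1) / 2))) (m := u)
    _ ct _) _.
  + by rewrite mulr_ge0 ?powR_ge0// ltW.
  + move=> v v0.
    have -> : - (c / t) * (u - v) ^+ 2 = - c * ((u - v) ^+ 2 / t).
      by field; rewrite gt_eqF.
    by rewrite -mulrA; exact: smallC.
  rewrite lee_fin /K.
  (* The rate c/t makes the norm of the Gaussian contribute t^(1/4), and -(j+1)/2 + 1/4 =
     -(2j+1)/4. *)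
  have -> : pi / (2 * (c / t)) = (pi / (2 * c)) * t.
    by field; rewrite !gt_eqF.
  have pc : 0 <= pi / (2 * c) by rewrite divr_ge0 ?pi_ge0// mulr_ge0// ltW.
  rewrite powRM ?(ltW t0)//.
  have -> : - ((2 * j%:R + 1) / 4) = - ((j%:R + 1) / 2) + 1 / 4 :> R by field.
  rewrite powRD; last by rewrite (gt_eqF t0) implybT.
  by rewrite le_eqVlt; apply/orP; left; apply/eqP; ring.
- apply: le_trans (L2norm_pos_gaussian (f := du_heat_kernel alpha j t u)
    (B := C * expR (- 2 * t * (alpha + 1))) (m := u)
    _ c0 _) _.
  + by rewrite mulr_ge0 ?expR_ge0// ltW.
  + by move=> v v0; rewrite -mulrA; exact: largeC.
  by rewrite lee_fin /K le_eqVlt; apply/orP; left; apply/eqP; ring.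
Qed.
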